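(* Suppose that the column space of $\boldsymbol{D}$ contains the constant vectors, i.e. $\boldsymbol{H}\boldsymbol{1} = \boldsymbol{1} := (1)_{i=1}^n$. Then, as $\eta := \max_{i=1,\ldots,n} H_{ii} \to 0$, $$\mathbb{E}\bigl( (\hat{R}_i - R_i)(\hat{R}_j - R_j) \bigr) = \frac{n^2 H_{ij} - n}{2\sqrt{4 - \delta_{ij}}\,\pi} + O\bigl( n\eta^{1/2} + n^2\eta^2 \bigr)$$ uniformly in $i,j \in \{1,2,\ldots,n\}$. That is, there exist universal constants $C, \eta_0 > 0$ such that for all $n$, $p$, $\sigma$ and all $\boldsymbol{D}$ as in the context with $\boldsymbol{H}\boldsymbol{1} = \boldsymbol{1}$ and $\eta \le \eta_0$, and for all $i,j \in \{1,\ldots,n\}$, the absolute difference between $\mathbb{E}\bigl( (\hat{R}_i - R_i)(\hat{R}_j - R_j) \bigr)$ and $\frac{n^2 H_{ij} - n}{2\sqrt{4 - \delta_{ij}}\,\pi}$ is at most $C\,( n\eta^{1/2} + n^2\eta^2 )$.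
   Context: Let $1 \le p < n$ be integers and let $\boldsymbol{D} \in \mathbb{R}^{n\times p}$ be a fixed (non-random) design matrix of full rank $p$. The hat matrix is $\boldsymbol{H} = (H_{ij})_{i,j=1}^n := \boldsymbol{D}(\boldsymbol{D}^\top\boldsymbol{D})^{-1}\boldsymbol{D}^\top$, i.e. the matrix of the orthogonal projection of $\mathbb{R}^n$ onto the column space of $\boldsymbol{D}$; its diagonal entries $H_{ii}$ are called leverages. Let $\varepsilon_1,\ldots,\varepsilon_n$ be independent random variables, each with distribution $\mathcal{N}(0,\sigma^2)$ for some $\sigma > 0$, let $\boldsymbol{\varepsilon} = (\varepsilon_i)_{i=1}^n$, and let $\hat{\boldsymbol{\varepsilon}} = (\hat{\varepsilon}_i)_{i=1}^n := (\boldsymbol{I} - \boldsymbol{H})\boldsymbol{\varepsilon}$, with $\boldsymbol{I}$ the $n\times n$ identity matrix. (These are the residuals of the least squares fit in the linear model $\boldsymbol{Y} = \boldsymbol{\mu} + \boldsymbol{\varepsilon}$ with $\boldsymbol{\mu}$ in the column space of $\boldsymbol{D}$.) The ranks are $$R_i := \sum_{j=1}^n 1_{[\varepsilon_j \le \varepsilon_i]}, \qquad \hat{R}_i := \sum_{j=1}^n 1_{[\hat{\varepsilon}_j \le \hat{\varepsilon}_i]}, \qquad 1 \le i \le n.$$ Here $\delta_{st} = 1_{[s=t]}$ is Kronecker's symbol. *)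

(* Defs.v *)
From HB Require Import structures.
From mathcomp Require Import all_boot all_order all_algebra.
From mathcomp Require Import all_classical all_reals all_analysis.

Set Implicit Arguments.
Unset Strict Implicit.
Unset Printing Implicit Defensive.

Import Order.TTheory GRing.Theory Num.Theory.
Import numFieldNormedType.Exports.

Local Open Scope classical_set_scope.
Local Open Scope ring_scope.

Definition hat_matrix (R : realType) (n p : nat) (D : 'M[R]_(n, p)) : 'M[R]_n :=
  D *m invmx (D^T *m D) *m D^T.

(* Starting the maximum at 0 is harmless because leverages are nonnegative. *)
Definition max_leverage (R : realType) (n p : nat) (D : 'M[R]_(n, p)) : R :=
  \big[Num.max/0]_(i < n) hat_matrix D i i.

Definition residual (R : realType) (n p : nat) (D : 'M[R]_(n, p))
    (e : 'cV[R]_n) : 'cV[R]_n :=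
  (1%:M - hat_matrix D) *m e.

Definition rank_of (R : realType) (n : nat) (x : 'cV[R]_n) (i : 'I_n) : nat :=
  (\sum_(j < n) (x j ord0 <= x i ord0)%R)%N.

Definition rank_error (R : realType) (n p : nat) (D : 'M[R]_(n, p))
    (e : 'cV[R]_n) (i : 'I_n) : R :=
  (rank_of (residual D e) i)%:R - (rank_of e i)%:R.

Definition random_vector (d : measure_display) (T : measurableType d)
    (R : realType) (P : probability T R) (n : nat)
    (X : 'I_n -> {RV P >-> R}) (w : T) : 'cV[R]_n :=
  \col_(i < n) X i w.

(* Mutual, not merely pairwise, independence. *)
Definition independent_RVs (d : measure_display) (T : measurableType d)
    (R : realType) (P : probability T R) (n : nat)
    (X : 'I_n -> {RV P >-> R}) : Prop :=
  forall (J : {set 'I_n}) (B : 'I_n -> set R),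
    (forall j, j \in J -> measurable (B j)) ->
    P (\bigcap_(j in [set` J]) (X j @^-1` B j)) =
    (\prod_(j in J) P (X j @^-1` B j))%E.

(* The second parameter of normal_prob is the standard deviation.  The laws are
   compared on Borel sets only, since normal_prob is an integral and has no
   meaning on non-measurable sets. *)
Definition centered_normal (d : measure_display) (T : measurableType d)
    (R : realType) (P : probability T R) (sigma : R)
    (X : {RV P >-> R}) : Prop :=
  forall B : set R, measurable B -> distribution P X B = normal_prob 0 sigma B.

(* Main.v *)
(* The product of the two rank errors is the sum over (k, l) of
   (1[^e_k <= ^e_i] - 1[e_k <= e_i]) (1[^e_l <= ^e_j] - 1[e_l <= e_j]), whose
   expectation is a combination of four orthant probabilities of centered
   bivariate normal vectors, each equal to 1/2 - acos(rho) / (2 pi).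

   The orthant formula: Givens rotations reduce two linear forms in independent
   normal variables to two linear forms in the plane, where the probability that
   two half-planes disagree is rotation invariant and exactly additive in the
   angle, hence proportional to it.

   For generic (k, l) the second-order expansion of acos around half the value
   d_ij of Kronecker's symbol gives h / (2 sqrt(4 - d_ij) pi) + O(eta^2) with
   h = H_kl - H_kj - H_il + H_ij, and these h sum to n^2 H_ij - n because
   H 1 = 1. The at most 3 n pairs with k = l, k = j or l = i contribute
   O(sqrt eta) each, which is the order of the angle between e_k - e_i and its
   projection ^e_k - ^e_i. *)
Require Import Defs.
From HB Require Import structures.
From mathcomp Require Import all_boot all_order all_algebra.
From mathcomp Require Import all_classical all_reals all_analysis.
From mathcomp Require Import measurable_realfun ring lra.

Set Implicit Arguments.
Unset Strict Implicit.
Unset Printing Implicit Defensive.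

Import Order.TTheory GRing.Theory Num.Theory.
Import numFieldNormedType.Exports.

Local Open Scope classical_set_scope.
Local Open Scope ring_scope.

(** * Measure-preserving shears of the plane *)

Section plane_lebesgue.
Context {R : realType}.
Local Notation RT := (measurableTypeR R).
Local Notation lam := (@lebesgue_measure R).
Local Notation lam2 := (lam \x lam)%E.

(** Packages the image measure as a bundled measure, which lets uniqueness theorems for measures be
    applied to it. *)
Lemma preimage_measure d (T : measurableType d) (m : {measure set T -> \bar R})
    d' (T' : measurableType d') (f : T -> T') (mf : measurable_fun setT f) :
  {m' : {measure set T' -> \bar R} | forall A, m' A = m (f @^-1` A)}.
Proof.
pose g : {mfun T >-> T'} := HB.pack f (isMeasurableFun.Build _ _ _ _ f mf).
exact: (exist _ (pushforward m g : {measure set T' -> \bar R}) (fun=> erefl)).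
Qed.

Lemma lebesgue_measure_translate (t : R) (A : set RT) :
  measurable A -> lam ((fun y => y + t) @^-1` A) = lam A.
Proof.
move=> mA.
have mt : measurable_fun [set: RT] (fun y : RT => y + t : RT).
  by apply: measurable_funD.
have [m mE] := preimage_measure lam mt.
rewrite -mE (@lebesgue_measure_unique R m)//.
move=> X [[a b] _ <-]; rewrite mE /=.
rewrite (_ : _ @^-1` _ = `]a - t, b - t]%classic); last first.
  by apply/seteqP; split=> x; rewrite /= !in_itv/= ltrBlDr lerBrDr.
rewrite !lebesgue_measure_itv/= !lte_fin ltrD2r.
by case: ifP => // _; rewrite -!EFinD; congr EFin; ring.
Qed.

Definition lam2_preserving (f : RT * RT -> RT * RT) :=
  measurable_fun setT f /\
  forall S, measurable S -> lam2 (f @^-1` S) = lam2 S.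

Lemma lam2_preserving_comp f g :
  lam2_preserving f -> lam2_preserving g -> lam2_preserving (f \o g).
Proof.
move=> [mf fE] [mg gE]; split; first exact: measurableT_comp.
move=> S mS; rewrite comp_preimage gE ?fE//.
by rewrite -[X in measurable X]setTI; exact: mf.
Qed.

(** The product measure integrates the lengths of vertical sections, and the shear only translates
    the section at [x] by [t * x]. *)
Lemma lam2_preserving_shear (t : R) :
  lam2_preserving (fun z => (z.1, z.2 + t * z.1)).
Proof.
split.
  apply/measurable_fun_pairP; split; first exact: measurable_fst.
  apply: measurable_funD; first exact: measurable_snd.
  by apply: measurable_funM; [exact: measurable_cst|exact: measurable_fst].
move=> S mS; apply: eq_integral => x _ /=.
have mx : measurable (xsection S x) by exact: measurable_xsection.
rewrite -[RHS](lebesgue_measure_translate (t * x) mx).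
by congr (lam _); apply/seteqP; split => y; rewrite /xsection/= !in_setE.
Qed.

Lemma lam2_preserving_swap : lam2_preserving (fun z => (z.2, z.1)).
Proof.
have mswap : measurable_fun [set: RT * RT] (fun z : RT * RT => (z.2, z.1)).
  exact: measurable_fun_pair measurable_snd measurable_fst.
split=> // S mS.
have [m mE] := preimage_measure lam2 mswap.
rewrite -mE; apply/esym/product_measure_unique => // A B mA mB.
rewrite mE (_ : _ @^-1` _ = B `*` A); last first.
  by apply/seteqP; split => -[x y] /= [].
by rewrite muleC; exact: product_measure1E.
Qed.

End plane_lebesgue.

(** * Rotation invariance of the planar Gaussian law *)

Definition gauss {R : realType} (s : R) : probability (measurableTypeR R) R :=
  normal_prob 0 s.

Definition gauss2 {R : realType} (s : R) :
    probability (measurableTypeR R * measurableTypeR R)%type R :=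
  (gauss s \x gauss s)%E.

Lemma gauss2X {R : realType} (s : R) (A B : set (measurableTypeR R)) :
  measurable A -> measurable B -> gauss2 s (A `*` B) = (gauss s A * gauss s B)%E.
Proof. by move=> mA mB; exact: product_measure1E. Qed.

Definition gauss2r {R : realType} (s : R)
    (A : set (measurableTypeR R * measurableTypeR R)) : R :=
  fine (gauss2 s A).

Section plane_gauss.
Context {R : realType}.
Variable s : R.
Hypothesis s0 : 0 < s.
Local Notation RT := (measurableTypeR R).
Local Notation lam := (@lebesgue_measure R).
Local Notation lam2 := (lam \x lam)%E.
Local Notation nu := (gauss s).
Local Notation nu2 := (gauss2 s).
Local Notation pdf := (@normal_pdf R 0 s).

Let q (z : RT * RT) : R := pdf z.1 * pdf z.2.

Let q_ge0 z : 0 <= q z.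
Proof. by rewrite mulr_ge0// normal_pdf_ge0. Qed.

Let mpdf : measurable_fun [set: RT] (pdf : RT -> R).
Proof. exact: measurable_normal_pdf. Qed.

Let mq : measurable_fun [set: RT * RT] (EFin \o q).
Proof.
apply/measurable_EFinP; apply: measurable_funM.
  by apply: (measurableT_comp mpdf); exact: measurable_fst.
by apply: (measurableT_comp mpdf); exact: measurable_snd.
Qed.

Let dens (S : set (RT * RT)) : \bar R := (\int[lam2]_(z in S) (q z)%:E)%E.

Let dens0 : dens set0 = 0%E.
Proof. by rewrite /dens integral_set0. Qed.

Let dens_ge0 S : (0 <= dens S)%E.
Proof. by apply: integral_ge0 => z _; rewrite lee_fin. Qed.

Let dens_sigma_additive : semi_sigma_additive dens.
Proof.
move=> F mF tF mUF; rewrite /dens ge0_integral_bigcup//; last first.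
- by move=> z _; rewrite lee_fin.
- exact: measurable_funTS.
apply: is_cvg_ereal_nneg_natsum_cond => n _ _.
by apply: integral_ge0 => z _; rewrite lee_fin.
Qed.

(** The measure with density [q] agrees with [gauss2] on rectangles by Tonelli, so uniqueness of
    product measures gives all measurable sets. *)
Lemma gauss2_density (S : set (RT * RT)) : measurable S ->
  nu2 S = (\int[lam2]_(z in S) (q z)%:E)%E.
Proof.
pose m : {measure set (RT * RT) -> \bar R} :=
  HB.pack dens (isMeasure.Build _ _ _ dens dens0 dens_ge0 dens_sigma_additive).
move=> mS; rewrite -[RHS]/(m S).
apply: product_measure_unique => // A B mA mB.
rewrite -[LHS]/(dens (A `*` B)) /dens integral_mkcond.
rewrite (fubini_tonelli1 (_ \_ _)) /=; first last.
- by move=> z; rewrite patchE; case: ifPn => // _; rewrite lee_fin.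
- apply/(measurable_restrictT _ _).1.
    exact: measurableX.
  exact: measurable_funTS.
rewrite /fubini_F.
have E x : (\int[lam]_y ((fun z => (q z)%:E) \_ (A `*` B)) (x, y)
   = (fun x => (pdf x)%:E * nu B) \_ A x)%E.
  have -> : nu B = (\int[lam]_(y in B) (pdf y)%:E)%E by [].
  rewrite [RHS]patchE [X in (_ * X)%E]integral_mkcond.
  case: ifPn => xA.
    rewrite -ge0_integralZl//; last by rewrite lee_fin normal_pdf_ge0.
    + apply: eq_integral => y _; rewrite !patchE.
      rewrite in_setX xA /=; case: ifPn => _; rewrite ?mule0//.
    + apply/(measurable_restrictT _ _).1 => //.
      by apply: measurable_funTS; exact/measurable_EFinP.
    + by move=> y _; rewrite patchE; case: ifPn; rewrite ?lee_fin ?normal_pdf_ge0.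
  by rewrite integral0_eq// => y _; rewrite patchE in_setX (negbTE xA).
under eq_integral do rewrite E.
rewrite -integral_mkcond.
rewrite ge0_integralZr//.
- by apply: measurable_funTS; exact/measurable_EFinP.
- by move=> y _; rewrite lee_fin normal_pdf_ge0.
Qed.

Definition gauss2_preserving (f : RT * RT -> RT * RT) :=
  measurable_fun setT f /\
  forall S : set (RT * RT), measurable S -> nu2 (f @^-1` S) = nu2 S.

Lemma gauss2r_preserving (f : RT * RT -> RT * RT) : gauss2_preserving f ->
  forall S : set (RT * RT), measurable S ->
  gauss2r s (f @^-1` S) = gauss2r s S.
Proof. by move=> [_ fE] S mS; rewrite /gauss2r fE. Qed.

(** The planar Gaussian density depends on a point only through its norm, so a change of variables
    that keeps both area and norm keeps the Gaussian measure. *)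
Lemma lam2_preserving_gauss2 (f : RT * RT -> RT * RT) :
  lam2_preserving f ->
  (forall z, (f z).1 ^+ 2 + (f z).2 ^+ 2 = z.1 ^+ 2 + z.2 ^+ 2) ->
  gauss2_preserving f.
Proof.
move=> [mf fE] fN; split; first exact: mf.
move=> S mS.
have mfS : measurable (f @^-1` S).
  by rewrite -(setTI (f @^-1` S)); exact: (mf measurableT S mS).
have qf z : q (f z) = q z.
  have pdfE x : pdf x = normal_peak s * normal_fun 0 s x.
    by rewrite normal_pdfE// gt_eqF.
  rewrite /q !pdfE mulrACA [RHS]mulrACA; congr (_ * _).
  rewrite /normal_fun -!expRD !subr0 -!mulrDl -!opprD.
  by rewrite fN.
have [m mE] := preimage_measure lam2 mf.
rewrite (gauss2_density mfS) (gauss2_density mS).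
transitivity (\int[lam2]_(z in f @^-1` S) ((EFin \o q) \o f) z)%E.
  by apply: eq_integral => z _ /=; rewrite qf.
rewrite -(ge0_integral_pushforward mf); last 3 first.
- exact: mS.
- exact: measurable_funTS.
- by move=> z _; rewrite lee_fin.
apply: eq_measure_integral => A mA _.
exact: fE.
Qed.

(** A rotation is a product of three shears, the outer two with slope [t / (1 + c)], the tangent of
    half the angle. This slope is undefined for the half turn [c = -1]. *)
Lemma gauss2_preserving_rot (c t : R) : c ^+ 2 + t ^+ 2 = 1 -> c != -1 ->
  gauss2_preserving (fun z => (c * z.1 + t * z.2, - t * z.1 + c * z.2)).
Proof.
move=> ct1 cN1; apply: lam2_preserving_gauss2; last first.
  move=> z /=; rewrite -[RHS]mul1r -ct1; ring.
have c1 : 1 + c != 0 by rewrite addrC; apply: contra cN1; rewrite addr_eq0.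
pose shx : RT * RT -> RT * RT := fun z => (z.1 + (t / (1 + c)) * z.2, z.2).
have lshx : lam2_preserving shx.
  have := lam2_preserving_comp lam2_preserving_swap (lam2_preserving_comp
    (lam2_preserving_shear (t / (1 + c))) lam2_preserving_swap).
  by [].
have := lam2_preserving_comp lshx
  (lam2_preserving_comp (lam2_preserving_shear (- t)) lshx).
congr lam2_preserving; apply/funext => -[x y] /=; rewrite /shx/=.
set k := t / (1 + c).
have k1c : k * (1 + c) = t by rewrite divfK.
have kt : k * t = 1 - c.
  apply: (mulIf c1); rewrite mulrAC k1c.
  by rewrite -expr2; lra.
congr pair.
  transitivity ((1 - k * t) * x + k * (2 - k * t) * y); first by ring.
  by rewrite kt -[t in RHS]k1c; ring.
transitivity (- t * x + (1 - k * t) * y); first by ring.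
by rewrite kt; ring.
Qed.

Lemma gauss2_preserving_flip2 : gauss2_preserving (fun z => (z.1, - z.2)).
Proof.
apply: lam2_preserving_gauss2; last by move=> z /=; rewrite sqrrN.
have shear := @lam2_preserving_shear R.
have swap := @lam2_preserving_swap R.
(* [(x, y) -> (x, - y)] is a quarter turn, that is three shears, after a swap *)
pose shx k : RT * RT -> RT * RT := fun z => (z.1 + k * z.2, z.2).
have lshx k : lam2_preserving (shx k).
  by have := lam2_preserving_comp swap (lam2_preserving_comp (shear k) swap).
have := lam2_preserving_comp (lam2_preserving_comp (lshx 1)
  (lam2_preserving_comp (shear (-1)) (lshx 1))) swap.
congr lam2_preserving; apply/funext => -[x y] /=; rewrite /shx/=.
by congr pair; ring.
Qed.

Lemma gauss2_preserving_flip1 : gauss2_preserving (fun z => (- z.1, z.2)).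
Proof.
apply: lam2_preserving_gauss2; last by move=> z /=; rewrite sqrrN.
have shear := @lam2_preserving_shear R.
have swap := @lam2_preserving_swap R.
pose shx k : RT * RT -> RT * RT := fun z => (z.1 + k * z.2, z.2).
have lshx k : lam2_preserving (shx k).
  by have := lam2_preserving_comp swap (lam2_preserving_comp (shear k) swap).
(* Here the swap comes after the quarter turn, which moves the sign to the first coordinate. *)
have := lam2_preserving_comp swap (lam2_preserving_comp (lshx 1)
  (lam2_preserving_comp (shear (-1)) (lshx 1))).
congr lam2_preserving; apply/funext => -[x y] /=; rewrite /shx/=.
by congr pair; ring.
Qed.

End plane_gauss.

(** * Orthant probabilities *)

Section probability_fine.
Context d (T : measurableType d) {R : realType} (P : probability T R).
Implicit Types A B : set T.

Local Notation pr A := (fine (P A)).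

Lemma fin_num_probability A : measurable A -> P A \is a fin_num.
Proof. by move=> mA; rewrite fin_num_measure. Qed.

Lemma fine_probabilityU A B : measurable A -> measurable B -> A `&` B = set0 ->
  pr (A `|` B) = pr A + pr B.
Proof.
move=> mA mB AB0; rewrite measureU//.
by rewrite fineD// fin_num_probability.
Qed.

Lemma fine_probability_ge0 A : 0 <= pr A.
Proof. exact: fine_ge0. Qed.

Lemma fine_probability_le1 A : measurable A -> pr A <= 1.
Proof.
move=> mA; rewrite -[leRHS]/(fine 1%E).
by rewrite fine_le ?fin_num_probability ?probability_le1.
Qed.

Lemma fine_probabilityI_D A B : measurable A -> measurable B ->
  pr A = pr (A `\` B) + pr (A `&` B).
Proof.
move=> mA mB; rewrite -fine_probabilityU.
- by rewrite setUC setUIDK.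
- exact: measurableD.
- exact: measurableI.
- by rewrite setDE setIACA setICl setI0.
Qed.

Lemma fine_probability_xor (p q : T -> bool) :
  measurable [set x | p x] -> measurable [set x | q x] ->
  pr [set x | p x != q x] =
  pr [set x | p x] + pr [set x | q x] - 2 * pr [set x | p x && q x].
Proof.
move=> mp mq.
rewrite (_ : [set x | p x != q x] = ([set x | p x] `\` [set x | q x]) `|`
    ([set x | q x] `\` [set x | p x])); last first.
  apply/seteqP; split => x /=; case: (p x); case: (q x) => //=.
  - by left.
  - by right.
  - by case=> -[].
  - by case=> -[].
rewrite fine_probabilityU; last 3 first.
- exact: measurableD.
- exact: measurableD.
- by apply/seteqP; split => x //= -[[? ?] []].
have -> : [set x | p x && q x] = [set x | p x] `&` [set x | q x].
  by apply/seteqP; split => x /= => [/andP[]|[-> ->]].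
have := fine_probabilityI_D mp mq; have := fine_probabilityI_D mq mp.
rewrite [X in _ = _ + pr X -> _]setIC; lra.
Qed.

End probability_fine.

Section orthant.
Context {R : realType}.
Variable s : R.
Hypothesis s0 : 0 < s.
Local Notation RT := (measurableTypeR R).
Local Notation nu := (gauss s).
Local Notation nu2 := (gauss2 s).
Local Notation pr := (gauss2r s).

Let prU (A B : set (RT * RT)) : measurable A -> measurable B -> A `&` B = set0 ->
  pr (A `|` B) = pr A + pr B.
Proof. exact: fine_probabilityU. Qed.

Let pr_xor (p q : RT * RT -> bool) :
  measurable [set x | p x] -> measurable [set x | q x] ->
  pr [set x | p x != q x] =
  pr [set x | p x] + pr [set x | q x] - 2 * pr [set x | p x && q x].
Proof. exact: fine_probability_xor. Qed.

Let prX (A B : set RT) : measurable A -> measurable B ->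
  pr (A `*` B) = fine (nu A) * fine (nu B).
Proof.
by move=> mA mB; rewrite /gauss2r gauss2X// fineM// fin_num_probability.
Qed.


Definition halfplane (a b : R) (z : RT * RT) : bool := a * z.1 + b * z.2 <= 0.

Lemma measurable_halfplane a b : measurable [set z | halfplane a b z].
Proof.
have mf : measurable_fun [set: RT * RT] (fun z : RT * RT => a * z.1 + b * z.2).
  apply: measurable_funD; apply: measurable_funM.
  - exact: measurable_cst.
  - exact: measurable_fst.
  - exact: measurable_cst.
  - exact: measurable_snd.
rewrite (_ : [set z | _] = (fun z : RT * RT => a * z.1 + b * z.2) @^-1` `]-oo, 0]).
  by rewrite -[X in measurable X]setTI; exact: (mf measurableT _ (measurable_itv _)).
by apply/seteqP; split => z; rewrite /halfplane /= in_itv.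
Qed.

Local Notation half t := (halfplane (cos t) (sin t)).

(** Disagreement is studied instead of joint occurrence because it is exactly additive in the
    angle. *)
#[local] Definition dis (t u : R) : R := pr [set z | half t z != half u z].

Let mdis t u : measurable [set z | half t z != half u z].
Proof.
have -> : [set z | half t z != half u z] =
  ([set z | half t z] `\` [set z | half u z]) `|`
  ([set z | half u z] `\` [set z | half t z]).
  apply/seteqP; split => x /=; case: (half t x); case: (half u x) => //=.
  - by left.
  - by right.
  - by case=> -[].
  - by case=> -[].
by apply: measurableU; apply: measurableD; exact: measurable_halfplane.
Qed.

Let cos_neqN1 (t : R) : 0 <= t < pi -> cos t != -1.
Proof.
move=> /andP[t0 tpi]; apply/eqP => ct.
suff tE : t = pi by rewrite tE ltxx in tpi.
by rewrite -[t]cosK ?ct ?acosN1// in_itv/= t0 ltW.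
Qed.

Let rotE (t u : R) z :
  half u (cos t * z.1 + sin t * z.2, - sin t * z.1 + cos t * z.2) =
  half (t + u) z.
Proof. by rewrite /halfplane /= cosD sinD; congr (_ <= _); ring. Qed.

Let half_rot t : 0 <= t < pi -> pr [set z | half t z] = pr [set z | half 0 z].
Proof.
move=> tpi.
have rE := gauss2r_preserving
  (gauss2_preserving_rot s0 (cos2Dsin2 t) (cos_neqN1 tpi)).
rewrite -[RHS](rE); last exact: measurable_halfplane.
congr (pr _); apply/seteqP; split => z /=; rewrite rotE addr0//.
Qed.

Let dis_rot t u : 0 <= t < pi -> dis t (t + u) = dis 0 u.
Proof.
move=> tpi.
have rE := gauss2r_preserving
  (gauss2_preserving_rot s0 (cos2Dsin2 t) (cos_neqN1 tpi)).
rewrite /dis -[RHS](rE); last exact: mdis.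
congr (pr _); apply/seteqP; split => z /=; rewrite !rotE addr0//.
Qed.

(* For [t1 < t2 < t3 < t1 + pi] the middle normal vector is a positive
   combination of the outer two, so a sign change from [t1] to [t3] happens
   either before or after [t2] but not both. *)
Let dis_add t u : 0 < t -> 0 < u -> t + u < pi ->
  dis 0 (t + u) = dis 0 t + dis 0 u.
Proof.
move=> t0 u0 tu.
have tp : 0 <= t < pi by apply/andP; split; lra.
have st : 0 < sin t by apply: sin_gt0_pi; apply/andP; split; lra.
have su : 0 < sin u by apply: sin_gt0_pi; apply/andP; split; lra.
have stu : 0 < sin (t + u) by apply: sin_gt0_pi; apply/andP; split; lra.
rewrite -(dis_rot u tp).
have mid z : sin (t + u) * (cos t * z.1 + sin t * z.2) =
    sin u * (cos 0 * z.1 + sin 0 * z.2) +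
    sin t * (cos (t + u) * z.1 + sin (t + u) * z.2).
  rewrite cos0 sin0 cosD sinD; have := cos2Dsin2 t => c2.
  transitivity (sin u * (cos t ^+ 2 + sin t ^+ 2) * z.1 -
    sin u * (sin t) ^+ 2 * z.1 + (sin t * cos u * cos t) * z.1
      + sin t * (sin t * cos u + cos t * sin u) * z.2); first by ring.
  by rewrite c2; ring.
have both z : half 0 z -> half (t + u) z -> half t z.
  rewrite /halfplane => h0 h1.
  by rewrite -(pmulr_rle0 _ stu) mid -[leRHS]addr0 lerD ?pmulr_rle0.
have none z : ~~ half 0 z -> ~~ half (t + u) z -> ~~ half t z.
  rewrite /halfplane -!ltNge => h0 h1.
  by rewrite -(pmulr_rgt0 _ stu) mid addr_gt0// pmulr_rgt0.
rewrite -prU; [|exact: mdis|exact: mdis|].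
  congr (pr _); apply/seteqP; split => z /=.
    move: (both z) (none z); case: (half 0 z); case: (half t z);
      case: (half (t + u) z) => //= b1 b2 _; by [left|right].
  move: (both z) (none z); case: (half 0 z); case: (half t z);
    case: (half (t + u) z) => b1 b2 //= -[] // _;
    by [have := b1 isT isT | have := b2 isT isT].
apply/seteqP; split => z //= -[].
move: (both z) (none z); case: (half 0 z); case: (half t z);
  case: (half (t + u) z) => b1 b2 //= _ _;
  by [have := b1 isT isT | have := b2 isT isT].
Qed.

Lemma gauss_set1 x : nu [set x] = 0%E.
Proof.
have /null_content_dominatesP dom := @normal_prob_dominates R 0 s.
by apply: dom => //; exact: lebesgue_measure_set1.
Qed.

Let nrT : fine (nu setT) = 1.
Proof. by rewrite probability_setT. Qed.

(** The reflection exchanges the two closed half-lines, which cover the line and meet only in the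
    null set [[set 0]]. *)
Let gauss_halfline : fine (nu [set x | x <= 0]) = 1 / 2.
Proof.
pose N : set RT := `]-oo, 0%R]%classic.
pose Q : set RT := `[0%R, +oo[%classic.
have -> : [set x | x <= 0] = N by apply/seteqP; split => x /=; rewrite /N/= in_itv.
have fE := gauss2r_preserving (gauss2_preserving_flip1 s0).
have mN : measurable N by exact: measurable_itv.
have mP : measurable Q by exact: measurable_itv.
have m0 : measurable ([set 0] : set RT) by exact: measurable_set1.
have E : fine (nu N) = fine (nu Q).
  have := fE (N `*` setT) (measurableX mN measurableT).
  rewrite (_ : _ @^-1` _ = Q `*` setT); last first.
    by apply/seteqP; split => z /=; rewrite /N /Q /= ?in_itv/= andbT oppr_le0.
  by rewrite (prX mN measurableT) (prX mP measurableT) nrT !mulr1 => ->.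
have U := fine_probabilityU nu mN (measurableD mP m0).
have := fine_probabilityI_D nu mP m0.
rewrite (_ : Q `&` [set 0] = [set 0]); last first.
  apply/seteqP; split => x /=; first by case.
  by move=> ->; rewrite /Q/= in_itv/= lexx.
rewrite gauss_set1 /= addr0 -E => NE; move: U.
rewrite (_ : _ `|` _ = setT); last first.
  apply/seteqP; split => x //= _; rewrite /N /Q /= ?in_itv/= andbT.
  by case: (leP x 0) => [|/[dup] /ltW ? /gt_eqF/eqP ?]; [left|right].
rewrite probability_setT -NE /= => U.
suff : 1 = fine (nu N) + fine (nu N) by lra.
apply: U; apply/seteqP; split => x //=; rewrite /N /Q /= ?in_itv/= andbT => -[x0 [x1 xE]].
by apply: xE; apply/eqP; rewrite eq_le x0.
Qed.

Let half0E z : half 0 z = (z.1 <= 0).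
Proof. by rewrite /halfplane cos0 sin0 mul1r mul0r addr0. Qed.

Let halfpi2E z : half (pi / 2) z = (z.2 <= 0).
Proof. by rewrite /halfplane cos_pihalf sin_pihalf mul1r mul0r add0r. Qed.

Let mN : measurable ([set x | x <= 0] : set RT).
Proof.
rewrite (_ : [set x | _] = `]-oo, 0%R]%classic); first exact: measurable_itv.
by apply/seteqP; split => x /=; rewrite in_itv.
Qed.

Let pr_half t : 0 <= t < pi -> pr [set z | half t z] = 1 / 2.
Proof.
move=> /half_rot ->; rewrite -gauss_halfline.
rewrite (_ : [set z | _] = [set x | x <= 0] `*` setT); last first.
  by apply/seteqP; split => z /=; rewrite half0E// => -[].
by rewrite (prX mN measurableT) nrT mulr1.
Qed.

Let dis_pihalf : dis 0 (pi / 2) = 1 / 2.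
Proof.
have pi0 := pi_gt0 R.
rewrite /dis pr_xor; [|exact: measurable_halfplane..].
have h0 : (0 : R) <= 0 < (pi : R) by apply/andP; split; lra.
have h2 : (0 : R) <= pi / 2 < (pi : R) by apply/andP; split; lra.
rewrite (pr_half h0) (pr_half h2).
rewrite (_ : [set z | _ && _] = [set x | x <= 0] `*` [set x | x <= 0]).
  rewrite (prX mN mN) gauss_halfline; lra.
apply/seteqP; split => z /=; rewrite half0E halfpi2E. by move=> /andP[].
by case=> -> ->.
Qed.

(** The deviation from proportionality. It inherits additivity from [dis], is bounded and vanishes
    at [pi / 2], which together force it to be zero. *)
#[local] Definition err t : R := dis 0 t - t / pi.

Let err_le1 t : 0 <= t < pi -> `|err t| <= 1.
Proof.
move=> /andP[t0 tpi]; have pi0 := pi_gt0 R.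
have d0 : 0 <= dis 0 t by exact: fine_probability_ge0.
have d1 : dis 0 t <= 1 by apply: fine_probability_le1; exact: mdis.
have q0 : 0 <= t / pi by rewrite divr_ge0// ltW.
have q1 : t / pi <= 1 by rewrite ler_pdivrMr// mul1r ltW.
by rewrite /err ler_norml; apply/andP; split; lra.
Qed.

Let err_add t u : 0 < t -> 0 < u -> t + u < pi -> err (t + u) = err t + err u.
Proof.
move=> t0 u0 tu; rewrite /err (dis_add t0 u0 tu) mulrDl opprD addrACA.
by [].
Qed.

Let err_pihalf : err (pi / 2) = 0.
Proof.
have pi0 := pi_gt0 R.
by rewrite /err dis_pihalf mulrAC divff ?gt_eqF// subrr.
Qed.

(* Doubling the angle modulo [pi / 2] doubles the error, which stays bounded. *)
Let err_doubling (m : nat) t : 0 < t < pi / 2 -> 2 ^+ m * `|err t| <= 1.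
Proof.
have pi0 := pi_gt0 R.
elim: m t => [|m IH] t /andP[t0 tpi].
  by rewrite expr0 mul1r err_le1//; apply/andP; split; lra.
have e2 : err (t + t) = 2 * err t by rewrite err_add ?mulr2n ?mulrDl ?mul1r//; lra.
have -> : 2 ^+ m.+1 * `|err t| = 2 ^+ m * `|err (t + t)|.
  by rewrite e2 normrM ger0_norm// exprSr mulrA.
have [lt|gt|eq] := ltgtP (t + t) (pi / 2).
- by apply: IH; rewrite lt andbT; lra.
- have -> : err (t + t) = err (t + t - pi / 2).
    have p1 : 0 < t + t - pi / 2 by rewrite subr_gt0.
    have p2 : (0 : R) < pi / 2 by rewrite divr_gt0.
    have p3 : t + t - pi / 2 + pi / 2 < pi by rewrite subrK; lra.
    by have := err_add p1 p2 p3; rewrite err_pihalf addr0 subrK.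
  by apply: IH; apply/andP; split; lra.
- by rewrite eq err_pihalf normr0 mulr0.
Qed.

Let err0 t : 0 <= t < pi -> err t = 0.
Proof.
have pi0 := pi_gt0 R.
have small u : 0 < u < pi / 2 -> err u = 0.
  move=> u0; apply/eqP; rewrite -normr_eq0; apply/eqP.
  apply/le_anti; rewrite normr_ge0 andbT leNgt; apply/negP => e0.
  (* A nonzero error would give [m] with [1 < m * |err u| <= 2 ^+ m * |err u|], against the doubling
     bound. *)
  have /= := archi_boundP (ltW (divr_gt0 (@ltr01 R) e0)).
  set m := Num.bound _; rewrite ltr_pdivrMr// => lt1.
  have := err_doubling m u0; rewrite leNgt => /negP; apply.
  apply: (lt_le_trans lt1); rewrite ler_pM2r// -natrX ler_nat.
  by rewrite ltnW// ltn_expl.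
move=> /andP[t0 tpi].
have [lt|gt|->] := ltgtP t (pi / 2); last exact: err_pihalf.
  move: t0; rewrite le_eqVlt => /predU1P[<-|t0]; last first.
    by apply: small; rewrite t0.
  rewrite /err mul0r subr0 /dis (_ : [set z | _] = set0).
    by rewrite /gauss2r measure0.
  by apply/seteqP; split => z //=; rewrite eqxx.
have p1 : 0 < t - pi / 2 by rewrite subr_gt0.
have p2 : (0 : R) < pi / 2 by rewrite divr_gt0.
have p3 : t - pi / 2 + pi / 2 < pi by rewrite subrK.
have := err_add p1 p2 p3; rewrite err_pihalf addr0 subrK => ->.
by apply: small; apply/andP; split; lra.
Qed.

(** For [t < pi] the disagreement probability [t / pi] equals [1 / 2 + 1 / 2] minus twice the joint
    probability. At [t = pi] the two half-planes share only a null line. *)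
Let orthant_angle t : 0 <= t <= pi ->
  pr [set z | half 0 z && half t z] = 1 / 2 - t / (2 * pi).
Proof.
have pi0 := pi_gt0 R.
move=> /andP[t0]; rewrite le_eqVlt => /predU1P[->|tpi].
  rewrite (_ : pi / _ = 1 / 2); last by rewrite invfM mulrCA divff ?gt_eqF// mulr1 mul1r.
  rewrite subrr (_ : [set z | _] = [set 0] `*` setT).
    by rewrite (prX (measurable_set1 0) measurableT) gauss_set1 mul0r.
  apply/seteqP; split => z; rewrite /halfplane /= cos0 sin0 cospi sinpi.
    by rewrite mul1r !mul0r !addr0 mulN1r oppr_le0 => /le_anti.
  by case=> -> _; rewrite mulr0 mulr0 !mul0r !addr0 lexx.
have tp : 0 <= t < pi by rewrite t0.
have := err0 tp; rewrite /err /dis pr_xor; [|exact: measurable_halfplane..].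
have h0 : (0 : R) <= 0 < (pi : R) by rewrite lexx.
rewrite (pr_half h0) (pr_half tp).
rewrite invfM mulrCA mulrA; lra.
Qed.

(** Reflections in the axes reduce to [0 < a] and [0 <= c]. The second normal then points in the
    direction [acos (b / r)], since its sine [c / r] is nonnegative. *)
Lemma orthant_probability (a b c : R) : a != 0 -> b ^+ 2 + c ^+ 2 != 0 ->
  pr [set z | halfplane a 0 z && halfplane b c z] =
  1 / 2 - acos (a * b / (`|a| * Num.sqrt (b ^+ 2 + c ^+ 2))) / (2 * pi).
Proof.
have mI a' b' c' : measurable [set z | halfplane a' 0 z && halfplane b' c' z].
  rewrite (_ : [set z | _] =
      [set z | halfplane a' 0 z] `&` [set z | halfplane b' c' z]).
    by apply: measurableI; exact: measurable_halfplane.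
  by apply/seteqP; split => z /= => [/andP[]|[-> ->]].
wlog a0 : a b / 0 < a.
  move=> wl a0 bc0; have [a_gt0|] := boolP (0 < a); first exact: wl.
  rewrite -leNgt le_eqVlt (negbTE a0) /= => a_lt0.
  have fE := gauss2r_preserving (gauss2_preserving_flip1 s0).
  rewrite -(fE _ (mI a b c)).
  have Na0 : 0 < - a by rewrite oppr_gt0.
  have := wl (- a) (- b) Na0; rewrite oppr_eq0 sqrrN mulrNN normrN.
  move=> /(_ a0 bc0) <-.
  congr (pr _); apply/seteqP; split => z;
  by rewrite /halfplane/= !mulrN !mulNr.
move=> _; wlog c0 : c / 0 <= c.
  move=> wl bc0; have [c_ge0|] := boolP (0 <= c); first exact: wl.
  rewrite -ltNge => c_lt0.
  have fE := gauss2r_preserving (gauss2_preserving_flip2 s0).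
  rewrite -(fE _ (mI a b c)).
  have Nc0 : 0 <= - c by rewrite oppr_ge0 ltW.
  have := wl (- c) Nc0; rewrite sqrrN => /(_ bc0) <-.
  congr (pr _); apply/seteqP; split => z;
  by rewrite /halfplane/= !mul0r !mulrN !mulNr.
move=> bc0.
have bc_gt0 : 0 < b ^+ 2 + c ^+ 2 by rewrite lt_def bc0 addr_ge0// sqr_ge0.
set r := Num.sqrt _; have r0 : 0 < r by rewrite sqrtr_gt0.
have r2 : r ^+ 2 = b ^+ 2 + c ^+ 2 by rewrite sqr_sqrtr// ltW.
have -> : a * b / (`|a| * r) = b / r.
  by rewrite gtr0_norm// -mulf_div divff ?gt_eqF// mul1r.
have br2 : 1 - (b / r) ^+ 2 = (c / r) ^+ 2.
  by rewrite !exprMn !exprVn r2; field.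
have br : -1 <= b / r <= 1.
  rewrite -ler_norml -(@expr_le1 _ 2)// -normrX ger0_norm ?sqr_ge0//.
  by have := sqr_ge0 (c / r); rewrite -br2; lra.
rewrite -orthant_angle; last by rewrite acos_ge0// acos_lepi.
have half0_a z : halfplane a 0 z = half 0 z.
  by rewrite half0E /halfplane mul0r addr0 pmulr_rle0.
have half_bc z : halfplane b c z = half (acos (b / r)) z.
  rewrite /halfplane acosK ?in_itv// sin_acos// br2 sqrtr_sqr.
  rewrite ger0_norm; last by rewrite divr_ge0// ltW.
  rewrite [b / r]mulrC [c / r]mulrC -!mulrA -mulrDr pmulr_rle0// invr_gt0//.
by congr (pr _); apply/seteqP; split => z /=; rewrite half0_a half_bc.
Qed.

End orthant.

(** * Independent normal variables in rotated coordinates *)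

Section gaussian_family.
Context d (T : measurableType d) {R : realType} (P : probability T R).
Variable s : R.
Hypothesis s0 : 0 < s.
Variable n : nat.
Local Notation RT := (measurableTypeR R).
Local Notation nu := (gauss s).
Implicit Types (X : 'I_n -> T -> RT) (B : 'I_n -> set RT) (a b v : 'I_n -> R).

(* Independent N(0, s^2) variables; [B j = setT] for some [j] gives the product
   rule for subfamilies and the marginal laws. *)
Definition gaussian_family X :=
  (forall j, measurable_fun setT (X j)) /\
  forall B, (forall j, measurable (B j)) ->
    P [set w | forall j, B j (X j w)] = (\prod_j nu (B j))%E.

(** Extends the product rule from rectangles in the coordinates [i] and [k] to arbitrary planar
    events, with the other variables still constrained. This is what permits rotating two
    coordinates while keeping the whole family independent. *)
Lemma gaussian_family_pair X (i k : 'I_n) B (S : set (RT * RT)) :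
  gaussian_family X -> i != k -> (forall j, measurable (B j)) -> measurable S ->
  P [set w | (forall j, j != i -> j != k -> B j (X j w)) /\ S (X i w, X k w)] =
  (\prod_(j | (j != i) && (j != k)) nu (B j) * gauss2 s S)%E.
Proof.
move=> [mX XE] ik mB mS.
have Xprod A C : measurable A -> measurable C ->
    P ([set w | forall j, j != i -> j != k -> B j (X j w)] `&`
       [set w | A (X i w) /\ C (X k w)]) =
    (\prod_(j | (j != i) && (j != k)) nu (B j) * (nu A * nu C))%E.
  move=> mA mC.
  pose B' j := if j == i then A else if j == k then C else B j.
  have B'i : B' i = A by rewrite /B' eqxx.
  have B'k : B' k = C by rewrite /B' eq_sym (negbTE ik) eqxx.
  have B'j j : j != i -> j != k -> B' j = B j.
    by rewrite /B' => /negbTE -> /negbTE ->.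
  have mB' j : measurable (B' j) by rewrite /B'; case: ifP => // _; case: ifP.
  have := XE B' mB'.
  rewrite (bigD1 i)//= (bigD1 k)/=; last by rewrite eq_sym.
  rewrite B'i B'k (eq_bigr (fun j => nu (B j))); last first.
    by move=> j /andP[ji jk]; rewrite B'j.
  rewrite muleA [RHS]muleC => <-.
  congr (P _); apply/seteqP; split => w /=.
    move=> [wB [wA wC]] j.
    have [->|ji] := eqVneq j i; first by rewrite B'i.
    have [->|jk] := eqVneq j k; first by rewrite B'k.
    by rewrite B'j//; exact: wB.
  move=> wB; split; first by move=> j ji jk; have := wB j; rewrite B'j.
  by split; [have := wB i; rewrite B'i|have := wB k; rewrite B'k].
pose E := [set w | forall j, j != i -> j != k -> B j (X j w)].
have mE : measurable E.
  rewrite (_ : E = \bigcap_(j in [set j | (j != i) && (j != k)]) (X j @^-1` B j)).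
    apply: fin_bigcap_measurable; first exact: finite_finset.
    by move=> j _; rewrite -(setTI (_ @^-1` _)); exact: (mX j measurableT _ (mB j)).
  apply/seteqP; split => w /= wE j; first by move=> /andP[]; exact: wE.
  by move=> ji jk; apply: wE; exact/andP.
have mXX : measurable_fun setT (fun w => (X i w, X k w)).
  exact: measurable_fun_pair (mX i) (mX k).
have [m mEq] := preimage_measure (mrestr P mE) mXX.
set c := (\prod_(j | _) _)%E.
have cE : c = P E.
  rewrite /c; have := Xprod _ _ measurableT measurableT.
  rewrite !probability_setT !mule1 => <-; congr (P _).
  by apply/seteqP; split => w //= -[].
have c_fin : c \is a fin_num by rewrite cE fin_num_probability.
have c_ge0 : 0 <= fine c by rewrite cE fine_ge0.
pose r := NngNum c_ge0.
have rE : (r%:num%:E = c)%E by rewrite /= fineK.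
(* Both sides are identified with the product of [mscale r nu] and [nu]: placing the constant in one
   factor makes uniqueness of product measures applicable. *)
have mU : m S = (r%:num%:E * gauss2 s S)%E.
  have U1 : (mscale r nu \x nu)%E S = m S.
    apply: product_measure_unique => [A C mA mC|//].
    rewrite mEq /mrestr -[X in _ = (X * _)%E]/(r%:num%:E * nu A)%E rE.
    rewrite -muleA -(Xprod _ _ mA mC) setIC.
    by congr (P _); apply/seteqP; split => w.
  have U2 : (mscale r nu \x nu)%E S = mscale r (gauss2 s) S.
    apply: product_measure_unique => [A C mA mC|//].
    by rewrite -[LHS]/(r%:num%:E * gauss2 s (A `*` C))%E gauss2X// muleA.
  by rewrite -U1 U2.
rewrite -rE -mU mEq; congr (P _).
by apply/seteqP; split => w /= [].
Qed.

Definition linear_form a X : T -> R := fun w => \sum_j a j * X j w.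

Definition dotp a b : R := \sum_j a j * b j.

(* [X'] and [F] describe the same linear forms in rotated coordinates. *)
Definition rotated X X' (F : ('I_n -> R) -> 'I_n -> R) :=
  [/\ gaussian_family X',
      forall v w, linear_form (F v) X' w = linear_form v X w &
      forall u v, dotp (F u) (F v) = dotp u v].

Lemma rotated_comp X X' X'' F G : rotated X X' F -> rotated X' X'' G ->
  rotated X X'' (G \o F).
Proof.
move=> [_ XF FF] [gX'' XG GG]; split => // [v w|u v] /=.
  by rewrite XG XF.
by rewrite GG FF.
Qed.

Lemma rotated_refl X : gaussian_family X -> rotated X X id.
Proof. by []. Qed.

Definition rot_coord (T' : Type) (i k : 'I_n) (x y : T') (Z : 'I_n -> T') :=
  fun j => if j == i then x else if j == k then y else Z j.

Lemma sum_rot_coord (i k : 'I_n) (f : 'I_n -> R) : i != k ->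
  \sum_j f j = f i + f k + \sum_(j | (j != i) && (j != k)) f j.
Proof.
by move=> ik; rewrite (bigD1 i)//= (bigD1 k)/= ?addrA// eq_sym.
Qed.

(** The same orthogonal map acts on the variables and on the coefficients, so forms and dot products
    are unchanged; rotation invariance of [gauss2] keeps the joint law. *)
Lemma rotated_givens X (i k : 'I_n) (c t : R) : i != k ->
  c ^+ 2 + t ^+ 2 = 1 -> c != -1 -> gaussian_family X ->
  exists X', rotated X X' (fun v => rot_coord i k (c * v i + t * v k)
                                                 (- t * v i + c * v k) v).
Proof.
move=> ik ct1 cN1 gX; have [mX XE] := gX.
exists (fun j w => rot_coord i k (c * X i w + t * X k w)
  (- t * X i w + c * X k w) (X^~ w) j).
have ki : (k == i) = false by rewrite eq_sym (negbTE ik).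
have ri (T' : Type) (x y : T') Z : rot_coord i k x y Z i = x.
  by rewrite /rot_coord eqxx.
have rk (T' : Type) (x y : T') Z : rot_coord i k x y Z k = y.
  by rewrite /rot_coord eqxx ki.
have rj (T' : Type) (x y : T') Z j : j != i -> j != k ->
    rot_coord i k x y Z j = Z j.
  by rewrite /rot_coord => /negbTE -> /negbTE ->.
split; first split.
- have mc (u v : R) : measurable_fun setT (fun w => u * X i w + v * X k w).
    apply: measurable_funD; apply: measurable_funM; try exact: measurable_cst;
    exact: mX.
  move=> j; rewrite /rot_coord; case: (j == i); first exact: mc.
  by case: (j == k); [exact: mc|exact: mX].
- move=> B mB.
  have [mr rE] := gauss2_preserving_rot s0 ct1 cN1.
  have mS : measurable (B i `*` B k) by exact: measurableX.
  have mrS := mr measurableT _ mS; rewrite setTI in mrS.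
  have := gaussian_family_pair gX ik mB mrS.
  rewrite rE// gauss2X// muleC -muleA => H.
  rewrite (bigD1 i)//= (bigD1 k)/= ?ki// -H.
  congr (P _); apply/seteqP; split => w /=.
    move=> wB; split; last by split; [have := wB i; rewrite ri|have := wB k; rewrite rk].
    by move=> j ji jk; have := wB j; rewrite rj.
  move=> [wB [wi wk]] j.
  have [->|ji] := eqVneq j i; first by rewrite ri.
  have [->|jk] := eqVneq j k; first by rewrite rk.
  by rewrite rj//; exact: wB.
- move=> v w; rewrite /linear_form !(sum_rot_coord _ ik) !ri !rk.
  congr (_ + _); last by apply: eq_bigr => j /andP[ji jk]; rewrite !rj.
  transitivity ((c ^+ 2 + t ^+ 2) * (v i * X i w + v k * X k w)); first by ring.
  by rewrite ct1 mul1r.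
- move=> u v; rewrite /dotp !(sum_rot_coord _ ik) !ri !rk.
  congr (_ + _); last by apply: eq_bigr => j /andP[ji jk]; rewrite !rj.
  transitivity ((c ^+ 2 + t ^+ 2) * (u i * v i + u k * v k)); first by ring.
  by rewrite ct1 mul1r.
Qed.

(** One Givens rotation in the plane of [i] and [k] for each [k] in [K] moves the weight of [a] at
    [k] into the pivot [i]. The last clause lets a second pass leave an already reduced form
    alone. *)
Lemma rotated_eliminate X (i : 'I_n) (K : seq 'I_n) a :
  i \notin K -> gaussian_family X ->
  exists X' F, [/\ rotated X X' F, forall k, k \in K -> F a k = 0,
    forall v j, j != i -> j \notin K -> F v j = v j &
    forall v, v i = 0 -> (forall k, k \in K -> v k = 0) -> F v = v].
Proof.
move=> iK gX; elim: K iK => [_|k K IH].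
  by exists X, id; split => //; exact: rotated_refl.
rewrite inE negb_or => /andP[ik iK]; have [X1 [F1 [r1 a1 o1 z1]]] := IH iK.
have [Fak0|Fak] := eqVneq (F1 a k) 0.
  exists X1, F1; split => //.
  - by move=> j; rewrite inE => /predU1P[->//|]; exact: a1.
  - by move=> v j ji; rewrite inE negb_or => /andP[_]; exact: o1.
  - by move=> v vi vK; apply: z1 => // j jK; apply: vK; rewrite inE jK orbT.
set x := F1 a i; set y := F1 a k in Fak.
have r2_gt0 : 0 < x ^+ 2 + y ^+ 2 by rewrite ltr_wpDl ?sqr_ge0// exprn_even_gt0.
set r := Num.sqrt (x ^+ 2 + y ^+ 2).
have r0 : 0 < r by rewrite sqrtr_gt0.
have r2 : r ^+ 2 = x ^+ 2 + y ^+ 2 by rewrite sqr_sqrtr// ltW.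
have ct1 : (x / r) ^+ 2 + (y / r) ^+ 2 = 1.
  by rewrite !exprMn -mulrDl -r2 -exprMn divff ?gt_eqF// expr1n.
(* A half turn would need [y = 0], the case in which no rotation is performed. *)
have cN1 : x / r != -1.
  apply/eqP => c1; move: ct1; rewrite c1 sqrrN expr1n => /eqP.
  rewrite addrC -subr_eq0 addrK sqrf_eq0 mulf_eq0 invr_eq0 (negbTE Fak).
  by rewrite gt_eqF.
have [gX1 _ _] := r1.
have [X2 r2'] := rotated_givens ik ct1 cN1 gX1.
exists X2; eexists; split; first exact: rotated_comp r1 r2'.
- move=> j; rewrite inE => jkK /=; rewrite /rot_coord.
  have [ji|ji] := eqVneq j i.
    by move: jkK; rewrite ji (negbTE ik) (negbTE iK).
  have [jk|jk] := eqVneq j k; first by rewrite -/x -/y; ring.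
  by apply: a1; move: jkK; rewrite (negbTE jk).
- move=> v j ji; rewrite inE negb_or => /andP[jk jK] /=.
  by rewrite /rot_coord (negbTE ji) (negbTE jk) o1.
- move=> v vi vK /=.
  have Fv : F1 v = v by apply: z1 => // j jK; apply: vK; rewrite inE jK orbT.
  rewrite Fv vi vK ?mem_head// !mulr0 addr0; apply/funext => j.
  rewrite /rot_coord; case: eqVneq => [->//|ji]; case: eqVneq => [->//|//].
  by rewrite vK ?mem_head.
Qed.

Lemma dotp_sym a b : dotp a b = dotp b a.
Proof. by apply: eq_bigr => j _; rewrite mulrC. Qed.

(** The first pass turns [a] onto axis [i]. The second, with pivot [k], clears all coordinates of
    [b] except [i] and [k]; it fixes the reduced [a], which vanishes at [k] and at every cleared
    coordinate. *)
Lemma rotated_plane X (i k : 'I_n) a b : i != k -> gaussian_family X ->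
  exists X' (u v x : R), [/\ gaussian_family X',
    forall w, linear_form a X w = u * X' i w,
    forall w, linear_form b X w = v * X' i w + x * X' k w,
    dotp a a = u ^+ 2 /\ dotp a b = u * v & dotp b b = v ^+ 2 + x ^+ 2].
Proof.
move=> ik gX.
have [X1 [F1 [r1 a1 _ _]]] := @rotated_eliminate X i
  [seq j <- enum 'I_n | j != i] a (ltac:(by rewrite mem_filter eqxx)) gX.
have [gX1 _ _] := r1.
have [X2 [F2 [r2 b2 o2 z2]]] := @rotated_eliminate X1 k
  [seq j <- enum 'I_n | (j != i) && (j != k)] (F1 b)
  (ltac:(by rewrite mem_filter eqxx andbF)) gX1.
have Fa j : j != i -> F1 a j = 0.
  by move=> ji; apply: a1; rewrite mem_filter ji mem_enum.
have F2a : F2 (F1 a) = F1 a.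
  apply: z2; first by rewrite Fa// eq_sym.
  by move=> j; rewrite mem_filter => /andP[/andP[ji _] _]; exact: Fa.
have Fb j : j != i -> j != k -> F2 (F1 b) j = 0.
  by move=> ji jk; apply: b2; rewrite mem_filter ji jk mem_enum.
have [gX2 r2L r2D] := r2; have [_ r1L r1D] := r1.
have sum1 (f : 'I_n -> R) : (forall j, j != i -> f j = 0) -> \sum_j f j = f i.
  by move=> f0; rewrite (bigD1 i)//= big1 ?addr0.
have sum2 (f : 'I_n -> R) : (forall j, j != i -> j != k -> f j = 0) ->
    \sum_j f j = f i + f k.
  move=> f0; rewrite (sum_rot_coord _ ik) big1 ?addr0// => j /andP[].
  exact: f0.
exists X2, (F1 a i), (F2 (F1 b) i), (F2 (F1 b) k); split => //.
- move=> w; rewrite -r1L -r2L F2a /linear_form sum1// => j ji.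
  by rewrite Fa// mul0r.
- move=> w; rewrite -r1L -r2L /linear_form sum2// => j ji jk.
  by rewrite Fb// mul0r.
- split.
    rewrite -r1D /dotp sum1// => j ji.
    by rewrite Fa// mul0r.
  rewrite -r1D -r2D F2a /dotp sum1// => j ji.
  by rewrite Fa// mul0r.
- rewrite -r1D -r2D /dotp sum2// => j ji jk.
  by rewrite Fb// mul0r.
Qed.

Lemma gaussian_family_orthant X a b : (1 < n)%N -> gaussian_family X ->
  dotp a a != 0 -> dotp b b != 0 ->
  fine (P [set w | (linear_form a X w <= 0) && (linear_form b X w <= 0)]) =
  1 / 2 - acos (dotp a b / (Num.sqrt (dotp a a) * Num.sqrt (dotp b b))) /
          (2 * pi).
Proof.
move=> n1 gX.
pose i : 'I_n := Ordinal (ltnW n1); pose k : 'I_n := Ordinal n1.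
have ik : i != k by [].
have [X' [u [v [x [gX' aE bE [uu ->] vv]]]]] := rotated_plane a b ik gX.
rewrite uu vv sqrtr_sqr sqrf_eq0 => u0 vx0.
rewrite -(orthant_probability s0 u0 vx0).
have mI : measurable [set z : RT * RT | halfplane u 0 z && halfplane v x z].
  rewrite (_ : [set z | _] =
      [set z | halfplane u 0 z] `&` [set z | halfplane v x z]).
    by apply: measurableI; exact: measurable_halfplane.
  by apply/seteqP; split => z /= => [/andP[]|[-> ->]].
have := gaussian_family_pair gX' ik (fun=> measurableT) mI.
rewrite big1 ?mul1e; last by move=> j _; rewrite probability_setT.
rewrite /gauss2r => <-; congr (fine (P _)).
apply/seteqP; split => w /=; rewrite /halfplane /= aE bE mul0r addr0 => //.
by case.
Qed.

Lemma measurable_linear_form X a : gaussian_family X ->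
  measurable_fun setT (linear_form a X).
Proof.
move=> [mX _]; apply: measurable_sum => j.
by apply: measurable_funM; [exact: measurable_cst|exact: mX].
Qed.

End gaussian_family.

(** * The hat matrix *)

Section hat_matrix_algebra.
Context {R : realType} (n p : nat) (D : 'M[R]_(n, p)).
Hypothesis rankD : \rank D = p.
Local Notation H := (hat_matrix D).
Local Notation eta := (max_leverage D).

(** A row vector [v] killed by the Gram matrix makes the squared norm of [v *m D^T] zero, and full
    rank then gives [v = 0]. *)
Let gram_unit : D^T *m D \in unitmx.
Proof.
rewrite -row_free_unit; apply: inj_row_free => v vDD.
have sq0 (u : 'rV[R]_n) : u *m u^T = 0 -> u = 0.
  move=> /matrixP/(_ 0 0); rewrite !mxE => /eqP.
  rewrite psumr_eq0; last by move=> j _; rewrite mxE -expr2 sqr_ge0.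
  move=> /allP u0; apply/rowP => j; apply/eqP.
  by have := u0 j (mem_index_enum j); rewrite [X in _ * X]mxE -expr2 sqrf_eq0 mxE.
have vD0 : v *m D^T = 0.
  by apply: sq0; rewrite trmx_mul trmxK mulmxA -(mulmxA v) vDD mul0mx.
have freeDT : row_free D^T by rewrite /row_free mxrank_tr rankD.
by apply: (row_free_inj freeDT); rewrite vD0 mul0mx.
Qed.

Lemma hat_matrix_tr : H^T = H.
Proof.
by rewrite /hat_matrix !trmx_mul trmxK trmx_inv trmx_mul trmxK mulmxA.
Qed.

Lemma hat_matrix_idem : H *m H = H.
Proof.
rewrite /hat_matrix !mulmxA -(mulmxA _ D^T D) -(mulmxA D (invmx _)).
by rewrite mulVmx// mulmx1.
Qed.

Lemma hat_matrixC i j : H i j = H j i.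
Proof. by rewrite -{1}hat_matrix_tr mxE. Qed.

Lemma hat_matrix_rowM i j : \sum_m H i m * H j m = H i j.
Proof.
rewrite -[in RHS]hat_matrix_idem mxE; apply: eq_bigr => m _.
by rewrite [H j m]hat_matrixC.
Qed.

Lemma hat_matrix_diag_le i : H i i <= eta.
Proof. exact: (le_bigmax 0 (fun i => H i i)). Qed.

Lemma max_leverage_ge0 : 0 <= eta.
Proof. exact: bigmax_ge_id. Qed.

(** Expanding the squared norms of the sum and the difference of rows [i] and [j], with [H] a
    symmetric idempotent, gives [2 * |H i j| <= H i i + H j j]. *)
Lemma hat_matrix_le i j : `|H i j| <= eta.
Proof.
have sqD (e : R) : e ^+ 2 = 1 ->
    \sum_m (H i m + e * H j m) ^+ 2 = H i i + H j j + 2 * e * H i j.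
  move=> e2; rewrite -!hat_matrix_rowM mulr_sumr -!big_split /=.
  apply: eq_bigr => m _.
  transitivity (H i m * H i m + e ^+ 2 * (H j m * H j m)
    + 2 * e * (H i m * H j m)); first by ring.
  by rewrite e2 mul1r.
have ge0 (e : R) : 0 <= \sum_m (H i m + e * H j m) ^+ 2.
  by apply: sumr_ge0 => m _; exact: sqr_ge0.
have := ge0 1; have := ge0 (-1); rewrite !sqD ?expr1n ?sqrrN ?expr1n//.
have := hat_matrix_diag_le i; have := hat_matrix_diag_le j.
by move=> *; rewrite ler_norml; apply/andP; split; lra.
Qed.

(* The covariance of [x_k - x_i] and [x_l - x_j] when [x] has covariance [M]. *)
Definition cross_diff (M : 'M[R]_n) (k i l j : 'I_n) : R :=
  M k l - M k j - M i l + M i j.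

Lemma cross_diff_hat_le k i l j : `|cross_diff H k i l j| <= 4 * eta.
Proof.
have := hat_matrix_le k l; have := hat_matrix_le k j.
have := hat_matrix_le i l; have := hat_matrix_le i j.
rewrite /cross_diff !ler_norml => /andP[? ?] /andP[? ?] /andP[? ?] /andP[? ?].
by apply/andP; split; lra.
Qed.

Lemma cross_diff_hat_ge0 k i : 0 <= cross_diff H k i k i.
Proof.
have -> : cross_diff H k i k i = \sum_m (H k m - H i m) ^+ 2.
  rewrite /cross_diff -!hat_matrix_rowM -!sumrB -big_split /=.
  by apply: eq_bigr => m _; ring.
by apply: sumr_ge0 => m _; exact: sqr_ge0.
Qed.

(** All row and column sums of [H] are 1, so the first three terms of [cross_diff] contribute
    [n - n - n]. *)
Lemma sum_cross_diff_hat i j : H *m const_mx 1 = const_mx 1 :> 'cV_n ->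
  \sum_k \sum_l cross_diff H k i l j = n%:R ^+ 2 * H i j - n%:R.
Proof.
move=> H1.
have row1 k : \sum_l H k l = 1.
  have /matrixP/(_ k 0) := H1; rewrite !mxE => <-.
  by apply: eq_bigr => l _; rewrite [const_mx _ _ _]mxE mulr1.
have col1 l : \sum_k H k l = 1.
  by rewrite -(row1 l); apply: eq_bigr => k _; exact: hat_matrixC.
have sumE k : \sum_l cross_diff H k i l j = 1 - H k j *+ n - 1 + H i j *+ n.
  by rewrite /cross_diff big_split sumrB sumrB /= !row1 !sumr_const card_ord.
rewrite (eq_bigr _ (fun k _ => sumE k)) big_split sumrB sumrB /=.
rewrite sumrMnl col1 !sumr_const card_ord -mulrnA -[H i j *+ _]mulr_natl natrM.
ring.
Qed.

Local Notation G := (1%:M - H).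

Let oneE a b : (1%:M : 'M[R]_n) a b = (a == b)%:R.
Proof. by rewrite mxE. Qed.

Let annE a b : G a b = (a == b)%:R - H a b.
Proof. by rewrite [LHS]mxE oneE; congr (_ + _); rewrite [LHS]mxE. Qed.

Lemma annihilator_rowM i j : \sum_m G i m * G j m = G i j.
Proof.
have GG : G *m G = G.
  by rewrite mulmxBl mul1mx mulmxBr mulmx1 hat_matrix_idem subrr subr0.
have GT a b : G a b = G b a.
  by rewrite !annE hat_matrixC eq_sym.
rewrite -[in RHS]GG mxE; apply: eq_bigr => m _.
by rewrite [G j m]GT.
Qed.

(* Coefficients of [e_k - e_i], respectively of the difference of the [k]-th and
   [i]-th residuals, as linear forms in [e]. *)
Definition true_diff (k i : 'I_n) : 'I_n -> R :=
  fun m => (m == k)%:R - (m == i)%:R.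

Definition residual_diff (k i : 'I_n) : 'I_n -> R := fun m => G k m - G i m.

Lemma dotp_true_diff k i l j :
  dotp (true_diff k i) (true_diff l j) = cross_diff 1%:M k i l j.
Proof.
have d a (f : 'I_n -> R) : \sum_m (m == a)%:R * f m = f a.
  rewrite (bigD1 a)//= eqxx mul1r big1 ?addr0// => m /negbTE ->.
  by rewrite mul0r.
rewrite /dotp /true_diff /cross_diff !mxE.
rewrite (eq_bigr (fun m => (m == k)%:R * ((m == l)%:R - (m == j)%:R) -
   (m == i)%:R * ((m == l)%:R - (m == j)%:R))); last first.
  by move=> m _; rewrite mulrBl.
by rewrite sumrB !d; ring.
Qed.

(** The value is that of [dotp_residual_diff], because [G] is an orthogonal projection and
    projecting the second vector as well changes nothing. *)
Lemma dotp_residual_true_diff k i l j :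
  dotp (residual_diff k i) (true_diff l j) =
  cross_diff 1%:M k i l j - cross_diff H k i l j.
Proof.
have d a (f : 'I_n -> R) : \sum_m f m * (m == a)%:R = f a.
  rewrite (bigD1 a)//= eqxx mulr1 big1 ?addr0// => m /negbTE ->.
  by rewrite mulr0.
rewrite /dotp /true_diff /residual_diff /cross_diff.
under eq_bigr do rewrite mulrBr.
by rewrite sumrB !d !annE !oneE; ring.
Qed.

Lemma dotp_residual_diff k i l j :
  dotp (residual_diff k i) (residual_diff l j) =
  cross_diff 1%:M k i l j - cross_diff H k i l j.
Proof.
transitivity (cross_diff G k i l j); last first.
  by rewrite /cross_diff !annE !oneE; ring.
rewrite /dotp /residual_diff /cross_diff -!annihilator_rowM -!sumrB -big_split /=.
by apply: eq_bigr => m _; ring.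
Qed.

Lemma residual_le (x : 'cV[R]_n) k i :
  (residual D x k ord0 <= residual D x i ord0) =
  (\sum_m residual_diff k i m * x m ord0 <= 0).
Proof.
rewrite -subr_le0; congr (_ <= _); rewrite /residual !mxE -sumrB.
by apply: eq_bigr => m _; rewrite /residual_diff mulrBl.
Qed.

Lemma true_le (x : 'cV[R]_n) k i :
  (x k ord0 <= x i ord0) = (\sum_m true_diff k i m * x m ord0 <= 0).
Proof.
have d a : \sum_m (m == a)%:R * x m ord0 = x a ord0.
  rewrite (bigD1 a)//= eqxx mul1r big1 ?addr0// => m /negbTE ->.
  by rewrite mul0r.
rewrite -subr_le0 -[in LHS](d k) -[in LHS](d i) -sumrB; congr (_ <= _).
by apply: eq_bigr => m _; rewrite mulrBl.
Qed.

End hat_matrix_algebra.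

(** * Expansion of the arc cosine *)

Section acos_estimates.
Context {R : realType}.
Implicit Types x y t : R.

(** A mean value theorem indifferent to the order of [x] and [y], which also locates the
    intermediate point relative to [x]. *)
Lemma MVT_between (f df : R -> R) (lo hi : R) x y :
  (forall z, lo <= z <= hi -> is_derive z 1 f (df z)) ->
  lo <= x <= hi -> lo <= y <= hi ->
  exists z, [/\ lo <= z <= hi, `|z - x| <= `|y - x| & f y - f x = df z * (y - x)].
Proof.
move=> fd.
have cf a b : lo <= a <= hi -> lo <= b <= hi -> {within `[a, b], continuous f}.
  move=> /andP[la _] /andP[_ bh]; apply: derivable_within_continuous => z.
  rewrite in_itv/= => /andP[az zb]; apply: (@ex_derive _ _ _ _ _ _ _ (fd z _)).
  by rewrite (le_trans la az) (le_trans zb bh).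
have mv a b : lo <= a <= hi -> lo <= b <= hi -> a < b ->
    exists2 z, a < z < b & f b - f a = df z * (b - a).
  move=> ha hb ab.
  have [z|z zab E] := @MVT R f df a b ab _ (cf a b ha hb).
    rewrite in_itv/= => /andP[az zb]; apply: fd.
    move: ha hb => /andP[la _] /andP[_ bh].
    by rewrite (le_trans la (ltW az)) (le_trans (ltW zb) bh).
  by exists z => //; move: zab; rewrite in_itv.
move=> hx hy; have [xy|yx|<-] := ltgtP x y.
- have [z /andP[xz zy] E] := mv _ _ hx hy xy; exists z; split => //.
    by move: hx hy => /andP[? ?] /andP[? ?]; apply/andP; split; lra.
  by rewrite !gtr0_norm ?subr_gt0//; lra.
- have [z /andP[yz zx] E] := mv _ _ hy hx yx; exists z; split => //.
  + by move: hx hy => /andP[? ?] /andP[? ?]; apply/andP; split; lra.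
  + by rewrite !ltr0_norm ?subr_lt0//; lra.
  + by rewrite -opprB E -mulrN opprB.
- by exists x; split => //; rewrite !subrr ?mulr0.
Qed.

(** By the mean value theorem the error is [y - x] times the change of [1 / sqrt (1 - z ^+ 2)]
    between [x] and an intermediate [z]. Both roots are at least [1 / 2], and [|z + x| <= 5 / 4], so
    the constant is [(5 / 4) / (1 / 4) = 5]. *)
Lemma acos_taylor x y : `|x| <= 1 / 2 -> `|y| <= 3 / 4 ->
  `|acos y - acos x + (y - x) / Num.sqrt (1 - x ^+ 2)| <= 5 * (y - x) ^+ 2.
Proof.
move=> x2 y2.
have sq_bd (z : R) : - (3 / 4) <= z <= 3 / 4 -> 1 / 2 <= Num.sqrt (1 - z ^+ 2).
  move=> /andP[z1 z2].
  have z3 : (1 / 2) ^+ 2 <= 1 - z ^+ 2 by nra.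
  by rewrite -[leLHS]gtr0_norm -?sqrtr_sqr ?ler_sqrt//; lra.
have dacos (z : R) : - (3 / 4) <= z <= 3 / 4 ->
    is_derive z 1 (@acos R) (- (Num.sqrt (1 - z ^+ 2))^-1).
  by move=> /andP[? ?]; apply: is_derive1_acos; apply/andP; split; lra.
rewrite ler_norml in x2; rewrite ler_norml in y2.
move: x2 y2 => /andP[x1 x2] /andP[y1 y2].
have hx : - (3 / 4) <= x <= 3 / 4 by apply/andP; split; lra.
have hy : - (3 / 4) <= y <= 3 / 4 by apply/andP; split; lra.
have [z [hz zx ->]] := MVT_between dacos hx hy.
set A := Num.sqrt (1 - z ^+ 2); set B := Num.sqrt (1 - x ^+ 2).
have A2 : 1 / 2 <= A := sq_bd z hz; have B2 : 1 / 2 <= B := sq_bd x hx.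
have AA : A ^+ 2 = 1 - z ^+ 2.
  by rewrite sqr_sqrtr//; move: hz => /andP[? ?]; nra.
have BB : B ^+ 2 = 1 - x ^+ 2 by rewrite sqr_sqrtr//; nra.
have -> : - A^-1 * (y - x) + (y - x) / B = (y - x) * (A - B) / (A * B).
  by field; apply/andP; split; apply: lt0r_neq0; lra.
have ABgt0 : 0 < A * B by rewrite mulr_gt0//; lra.
rewrite normrM normfV (gtr0_norm ABgt0) ler_pdivrMr// normrM.
have -> : (y - x) ^+ 2 = `|y - x| ^+ 2 by rewrite real_normK ?num_real.
set Y := `|y - x| in zx *.
have Y0 : 0 <= Y by exact: normr_ge0.
have AB : `|A - B| <= 5 / 4 * Y.
  have S : 1 <= A + B by lra.
  have : `|A - B| * (A + B) = `|z - x| * `|z + x|.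
    rewrite -[in LHS](gtr0_norm (lt_le_trans ltr01 S)) -!normrM.
    rewrite -!subr_sqr AA BB; rewrite -normrN; congr `|_|; ring.
  have : `|z + x| <= 5 / 4.
    by move: hz => /andP[? ?]; rewrite ler_norml; apply/andP; split; lra.
  have := normr_ge0 (A - B); have := normr_ge0 (z + x); have := normr_ge0 (z - x).
  move: `|A - B| `|z + x| `|z - x| zx => p q r; nra.
have AB4 : 1 / 4 <= A * B by nra.
have := normr_ge0 (A - B); move: `|A - B| AB => p; nra.
Qed.

(** The angle [t] on the left has sine [sqrt x], and [sin t = cos z * t] for some [z] in [[0, t]],
    where [cos z >= cos t >= 1 / 2]. *)
Lemma acos_sqrt_le x : 0 <= x <= 3 / 4 -> acos (Num.sqrt (1 - x)) <= 2 * Num.sqrt x.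
Proof.
move=> /andP[x0 x1]; set q := Num.sqrt (1 - x).
have q2 : q ^+ 2 = 1 - x by rewrite sqr_sqrtr//; lra.
have q0 : 0 <= q := sqrtr_ge0 _.
have qle1 : q <= 1 by nra.
have qhalf : 1 / 2 <= q by nra.
have hq : -1 <= q <= 1 by apply/andP; split; lra.
set t := acos q; have t0 : 0 <= t by exact: acos_ge0.
have tpi : t <= pi by exact: acos_lepi.
have sint : sin t = Num.sqrt x by rewrite sin_acos// q2; congr Num.sqrt; ring.
have [z [/andP[z0 zt] _]] := @MVT_between sin cos 0 t 0 t
  (fun z _ => is_derive_sin z) (introT andP (conj (lexx 0) t0))
  (introT andP (conj t0 (lexx t))).
rewrite sin0 !subr0 sint => ->.
have : q <= cos z.
  rewrite -[leLHS](@acosK _ q) ?in_itv// leNgt ltr_cos -?leNgt// in_itv/=.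
    by rewrite t0 tpi.
  by rewrite z0 (le_trans zt tpi).
by move: (cos z) => c; nra.
Qed.

(* With [a / 2] the correlation before the projection, the first-order part of
   the four-term difference is exactly
   [h / 2 + (a - h) / 2 * (su - 1) * (sv - 1)] times the slope of [acos] at
   [a / 2], where [su = 1 / sqrt (1 - u / 2)]. *)
Lemma acos_four_term (delta : bool) (h u v e : R) (a := delta%:R : R) :
  0 <= e <= 1 / 48 -> `|h| <= 4 * e -> 0 <= u <= 4 * e -> 0 <= v <= 4 * e ->
  `|(1 / 2 - acos ((a - h) / (Num.sqrt (2 - u) * Num.sqrt (2 - v))) / (2 * pi))
    - (1 / 2 - acos ((a - h) / (Num.sqrt (2 - u) * Num.sqrt 2)) / (2 * pi))
    - (1 / 2 - acos ((a - h) / (Num.sqrt 2 * Num.sqrt (2 - v))) / (2 * pi))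
    + (1 / 2 - acos (a / (Num.sqrt 2 * Num.sqrt 2)) / (2 * pi))
    - h / (2 * Num.sqrt (4 - a) * pi)| <= 300 * e ^+ 2.
Proof.
move=> /andP[e0 e1] he hu hv.
have a01 : 0 <= a <= 1 by rewrite /a; case: (delta); rewrite ?lexx ?ler01.
have aa : a ^+ 2 = a by rewrite /a; case: (delta); rewrite ?expr1n ?expr0n.
move: a a01 aa => {delta} a /andP[a0 a1] aa.
pose w := Num.sqrt 2 : R.
have ww : w ^+ 2 = 2 by rewrite sqr_sqrtr.
have w0 : 0 < w by rewrite sqrtr_gt0.
pose S z := w / Num.sqrt (2 - z).
have SE z : 0 <= z <= 4 * e -> [/\ 0 < Num.sqrt (2 - z), 0 <= S z - 1 & S z - 1 <= 4 * e].
  move=> /andP[z0 z1]; set q := Num.sqrt (2 - z).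
  have q2 : q ^+ 2 = 2 - z by rewrite sqr_sqrtr//; lra.
  have q0 : 0 < q by rewrite sqrtr_gt0; lra.
  have wq : q <= w by nra.
  have S1 : 1 <= S z by rewrite /S -/q ler_pdivlMr// mul1r.
  have S2 : (S z) ^+ 2 * (2 - z) = 2.
    by rewrite /S -/q -q2 -exprMn divfK ?gt_eqF.
  have z3 : 0 <= 2 - z by lra.
  (* Replacing the square of [S z] by its tangent at 1 leaves an inequality linear in [S z]. *)
  have S3 : (1 + 2 * (S z - 1)) * (2 - z) <= 2.
    rewrite -[leRHS]S2 ler_wpM2r//.
    by have := sqr_ge0 (S z - 1); rewrite sqrrB expr1n mulr1; lra.
  split => //; first by lra.
  move: (S z) S1 S3 => Sz S1 S3.
  have : (Sz - 1) * z <= (Sz - 1) * 1 by apply: ler_wpM2l; lra.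
  lra.
have [qu0 su0 su1] := SE u hu; have [qv0 sv0 sv1] := SE v hv.
have Eu (c : R) : c / (Num.sqrt (2 - u) * w) = c / 2 * S u.
  by rewrite /S -[X in c / X * _]ww; field; rewrite !gt_eqF.
have Ev (c : R) : c / (w * Num.sqrt (2 - v)) = c / 2 * S v.
  by rewrite /S -[X in c / X * _]ww; field; rewrite !gt_eqF.
have Euv (c : R) : c / (Num.sqrt (2 - u) * Num.sqrt (2 - v)) = c / 2 * S u * S v.
  by rewrite /S -[X in c / X * _ * _]ww; field; rewrite !gt_eqF.
have Ew (c : R) : c / (w * w) = c / 2 by rewrite -expr2 ww.
rewrite -/w Euv Eu Ev Ew.
set r1 := (a - h) / 2 * S u * S v; set r2 := (a - h) / 2 * S u.
set r3 := (a - h) / 2 * S v; set x := a / 2.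
have rel : r1 - r2 - r3 + x = h / 2 + (a - h) / 2 * ((S u - 1) * (S v - 1)).
  by rewrite /r1 /r2 /r3 /x; field.
have hE := he; rewrite ler_norml in hE; move: hE => /andP[h1 h2].
have ah : `|(a - h) / 2| <= 1 by rewrite ler_norml; apply/andP; split; lra.
have prod0 : 0 <= (S u - 1) * (S v - 1) by exact: mulr_ge0.
have prod1 : (S u - 1) * (S v - 1) <= 16 * e ^+ 2.
  by have := ler_pM su0 sv0 su1 sv1; lra.
have prod2 : (S u - 1) * (S v - 1) <= 2 * e by nra.
have bnd (y z : R) : `|y| <= 1 -> 0 <= z -> `|y * z| <= z.
  by move=> y1 z0; rewrite normrM (ger0_norm z0) ler_piMl.
(* The parts are [2 + 4 + 4] from the norm factors and 2 from [h / 2]; for [r2] and [r3] below they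
   are [4 + 2]. The hypothesis [e <= 1 / 48] makes [12 * e <= 1 / 4], so the three arguments stay in
   the range of [acos_taylor]. *)
have d1 : `|r1 - x| <= 12 * e.
  have -> : r1 - x = (a - h) / 2 *
      ((S u - 1) * (S v - 1) + (S u - 1) + (S v - 1)) - h / 2.
    by rewrite /r1 /x; field.
  apply: le_trans (ler_normB _ _) _.
  have := bnd _ _ ah (addr_ge0 (addr_ge0 prod0 su0) sv0).
  have -> : `|h / 2| = `|h| / 2 by rewrite normrM [X in _ * X]ger0_norm.
  lra.
have d2 : `|r2 - x| <= 6 * e.
  have -> : r2 - x = (a - h) / 2 * (S u - 1) - h / 2 by rewrite /r2 /x; field.
  apply: le_trans (ler_normB _ _) _; have := bnd _ _ ah su0.
  have -> : `|h / 2| = `|h| / 2 by rewrite normrM [X in _ * X]ger0_norm.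
  lra.
have d3 : `|r3 - x| <= 6 * e.
  have -> : r3 - x = (a - h) / 2 * (S v - 1) - h / 2 by rewrite /r3 /x; field.
  apply: le_trans (ler_normB _ _) _; have := bnd _ _ ah sv0.
  have -> : `|h / 2| = `|h| / 2 by rewrite normrM [X in _ * X]ger0_norm.
  lra.
clearbody r1 r2 r3.
have x2 : `|x| <= 1 / 2 by rewrite ler_norml /x; apply/andP; split; lra.
have tay r k : `|r - x| <= k * e -> k * e <= 1 / 4 ->
    `|acos r - acos x + (r - x) / Num.sqrt (1 - x ^+ 2)| <= 5 * (k * e) ^+ 2.
  move=> rk k4; have rx : `|r| <= 3 / 4.
    have -> : r = (r - x) + x by rewrite subrK.
    by apply: le_trans (ler_normD _ _) _; lra.
  apply: le_trans (acos_taylor x2 rx) _.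
  rewrite ler_pM2l// -(real_normK (num_real (r - x))).
  by rewrite lerXn2r// nnegrE// (le_trans _ rk).
have t1 := tay _ _ d1 (ltac:(lra)); have t2 := tay _ _ d2 (ltac:(lra)).
have t3 := tay _ _ d3 (ltac:(lra)).
set Q := Num.sqrt (4 - a).
have Q0 : 0 < Q by rewrite sqrtr_gt0; lra.
have QQ : Q ^+ 2 = 4 - a by rewrite sqr_sqrtr//; lra.
(* Since [a] is 0 or 1, [a ^+ 2 = a] and [1 - (a / 2) ^+ 2 = (4 - a) / 4]. *)
have KQ : Num.sqrt (1 - x ^+ 2) = Q / 2.
  rewrite (_ : 1 - x ^+ 2 = (Q / 2) ^+ 2).
    by rewrite sqrtr_sqr ger0_norm// divr_ge0// ltW.
  by rewrite [RHS]exprMn QQ [in LHS]/x [in LHS]exprMn aa; field.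
have Q1 : 1 <= Q by nra.
rewrite KQ in t1; rewrite KQ in t2; rewrite KQ in t3.
clearbody x Q.
have pi2 := pi_ge2 R; have pi0 := pi_gt0 R.
move: (@pi R) pi2 pi0 => PI pi2 pi0.
pose E1 := acos r1 - acos x + (r1 - x) / (Q / 2).
pose E2 := acos r2 - acos x + (r2 - x) / (Q / 2).
pose E3 := acos r3 - acos x + (r3 - x) / (Q / 2).
rewrite -/E1 in t1; rewrite -/E2 in t2; rewrite -/E3 in t3.
have -> : (1 / 2 - acos r1 / (2 * PI)) - (1 / 2 - acos r2 / (2 * PI))
    - (1 / 2 - acos r3 / (2 * PI)) + (1 / 2 - acos x / (2 * PI))
    - h / (2 * Q * PI) =
    (((a - h) / 2 * ((S u - 1) * (S v - 1))) * 2 / Q - (E1 - E2 - E3)) / (2 * PI).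
  have -> : (a - h) / 2 * ((S u - 1) * (S v - 1)) = r1 - r2 - r3 + x - h / 2.
    by rewrite rel; ring.
  rewrite /E1 /E2 /E3; move: (acos r1) (acos r2) (acos r3) (acos x) => y1 y2 y3 y.
  by field; rewrite !gt_eqF.
rewrite normrM normfV [X in _ / X]gtr0_norm; last by rewrite mulr_gt0.
rewrite ler_pdivrMr; last by rewrite mulr_gt0.
have m1 : `|(a - h) / 2 * ((S u - 1) * (S v - 1)) * 2 / Q| <= 32 * e ^+ 2.
  rewrite normrM normfV (gtr0_norm Q0) ler_pdivrMr// normrM [X in _ * X]ger0_norm//.
  apply: (@le_trans _ _ (32 * e ^+ 2)); first by have := bnd _ _ ah prod0; lra.
  by rewrite ler_peMr// mulr_ge0// sqr_ge0.
(* The numerator is at most [32 + 5 * (144 + 36 + 36) = 1112] times [e ^+ 2], and [2 * PI >= 4]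
   brings this below 300. *)
apply: le_trans (ler_normB _ _) _.
have := ler_normB (E1 - E2) E3; have := ler_normB E1 E2.
have := sqr_ge0 e; move: t1 t2 t3 m1; rewrite !exprMn.
move: (`|E1|) (`|E2|) (`|E3|) (`|E1 - E2|) (`|E1 - E2 - E3|) => f1 f2 f3 f4 f5.
move: (`|_|) (e ^+ 2) => f6 ee; nra.
Qed.

End acos_estimates.

(** * Moments of the rank errors *)

Section bounded_means.
Context d (T : measurableType d) {R : realType} (P : probability T R).
Implicit Types f g : T -> R.

(** Integrability travels with the value because additivity of the integral requires it. *)
Definition has_mean f (m : R) :=
  P.-integrable setT (EFin \o f) /\ (\int[P]_w (f w)%:E)%E = m%:E.

Lemma has_mean_expectation f m : has_mean f m -> ('E_P[f] = m%:E)%E.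
Proof. by move=> [_ fm]; rewrite unlock. Qed.

Lemma has_mean_indic (b : T -> bool) : measurable [set w | b w] ->
  has_mean (fun w => (b w)%:R) (fine (P [set w | b w])).
Proof.
move=> mb; have E : (fun w => (b w)%:R) = \1_[set w | b w] :> (T -> R).
  by apply/funext => w; rewrite indicE; congr (nat_of_bool _)%:R;
    apply/idP/idP; rewrite inE.
rewrite E; split.
  apply/integrableP; split; first exact/measurable_EFinP/measurable_indic.
  under eq_integral => w _ do rewrite /= ger0_norm//.
  rewrite integral_indic// setIT (le_lt_trans (probability_le1 _ _))// ltry//.
rewrite integral_indic// setIT fineK// fin_num_probability//.
Qed.

Lemma has_meanD f g m k : has_mean f m -> has_mean g k ->
  has_mean (fun w => f w + g w) (m + k).
Proof.
move=> [fi fm] [gi gk]; split; first exact: (integrableD measurableT fi gi).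
under eq_integral do rewrite EFinD.
by rewrite (integralD measurableT fi gi) fm gk.
Qed.

Lemma has_meanN f m : has_mean f m -> has_mean (fun w => - f w) (- m).
Proof.
move=> [fi fm]; split.
  exact: (integrableN fi).
under eq_integral do rewrite EFinN.
by rewrite (integralN) ?fm//; exact: integrable_add_def.
Qed.

Lemma has_meanB f g m k : has_mean f m -> has_mean g k ->
  has_mean (fun w => f w - g w) (m - k).
Proof. by move=> fm /has_meanN; exact: has_meanD. Qed.

Lemma has_mean_sum (I : finType) (f : I -> T -> R) (m : I -> R) :
  (forall i, has_mean (f i) (m i)) ->
  has_mean (fun w => \sum_i f i w) (\sum_i m i).
Proof.
move=> fm; elim: (index_enum I) => [|i r IH].
  have -> : (fun w => \sum_(i <- [::]) f i w) = cst 0.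
    by apply/funext => w; rewrite big_nil.
  rewrite big_nil; split; first exact: integrable0.
  by rewrite integral0.
have -> : (fun w => \sum_(j <- i :: r) f j w) =
    (fun w => f i w + \sum_(j <- r) f j w).
  by apply/funext => w; rewrite big_cons.
by rewrite big_cons; exact: has_meanD.
Qed.

Lemma has_mean_le f g m k : has_mean f m -> has_mean g k ->
  (forall w, f w <= g w) -> m <= k.
Proof.
move=> [fi fm] [gi gk] fg; rewrite -lee_fin -fm -gk.
by apply: le_integral => // w _; rewrite lee_fin.
Qed.

End bounded_means.

Lemma independent_normal_gaussian_family d (T : measurableType d) (R : realType)
    (P : probability T R) (s : R) n (eps : 'I_n -> {RV P >-> R}) :
  independent_RVs eps -> (forall i, centered_normal s (eps i)) ->
  gaussian_family P s (fun i => eps i : T -> measurableTypeR R).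
Proof.
move=> ind nor; split.
  by move=> j; exact: (measurable_funP (eps j)).
move=> B mB; have := ind [set: 'I_n]%SET B (fun j _ => mB j).
rewrite (_ : \bigcap_(j in _) _ = [set w | forall j, B j (eps j w)]); last first.
  apply/seteqP; split => w /=; first by move=> wB j; apply: wB; rewrite /= inE.
  by move=> wB j _; exact: wB.
move=> ->; apply: eq_big => [j|j _]; first by rewrite inE.
exact: (nor j (B j) (mB j)).
Qed.

Section rank_moments.
Context d (T : measurableType d) {R : realType} (P : probability T R).
Variables (s : R) (n p : nat) (D : 'M[R]_(n, p)).
Variable X : 'I_n -> T -> measurableTypeR R.
Hypothesis s0 : 0 < s.
Hypothesis n1 : (1 < n)%N.
Hypothesis rankD : \rank D = p.
Hypothesis gX : gaussian_family P s X.
Local Notation H := (hat_matrix D).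
Local Notation eta := (max_leverage D).
Hypothesis eta_small : eta <= 1 / 48.
Local Notation g := (residual_diff D).
Local Notation f := (@true_diff R n).
Local Notation L a := (linear_form a X).

Let neg a w : bool := L a w <= 0.

Let q a b : R := fine (P [set w | neg a w && neg b w]).

(** The contribution of index [k] to the rank error of index [i]. *)
Let Y k i w : R := (neg (g k i) w)%:R - (neg (f k i) w)%:R.

Let m k i l j : R :=
  q (g k i) (g l j) - q (g k i) (f l j) - q (f k i) (g l j) + q (f k i) (f l j).

Let mean_q a b : has_mean P (fun w => (neg a w)%:R * (neg b w)%:R) (q a b).
Proof.
have mL c : measurable [set w | neg c w].
  rewrite (_ : [set w | _] = L c @^-1` `]-oo, 0%R]%classic).
    rewrite -(setTI (_ @^-1` _)).
    exact: (measurable_linear_form c gX measurableT (measurable_itv _)).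
  by apply/seteqP; split => w /=; rewrite in_itv.
rewrite (_ : (fun w => _) = (fun w => (neg a w && neg b w)%:R)); last first.
  by apply/funext => w; rewrite -natrM mulnb.
apply: has_mean_indic.
rewrite (_ : [set w | _] = [set w | neg a w] `&` [set w | neg b w]).
  exact: measurableI.
by apply/seteqP; split => w /= => [/andP[]|[-> ->]].
Qed.

Let mean_Y k i l j : has_mean P (fun w => Y k i w * Y l j w) (m k i l j).
Proof.
rewrite (_ : (fun w => _) = (fun w =>
    (neg (g k i) w)%:R * (neg (g l j) w)%:R -
    (neg (g k i) w)%:R * (neg (f l j) w)%:R -
    (neg (f k i) w)%:R * (neg (g l j) w)%:R +
    (neg (f k i) w)%:R * (neg (f l j) w)%:R)); last first.
  by apply/funext => w; rewrite /Y mulrBl !mulrBr opprB addrA addrAC.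
by apply: has_meanD; first apply: has_meanB; first apply: has_meanB;
  exact: mean_q.
Qed.

Let norm_f k i : k != i -> dotp (f k i) (f k i) = 2.
Proof.
move=> ki; rewrite dotp_true_diff /cross_diff !mxE !eqxx [i == k]eq_sym (negbTE ki).
by rewrite !subr0 -mulr2n.
Qed.

(** The squared length that the difference of two basis vectors loses when projected onto the
    residual space. *)
Let u k i : R := cross_diff H k i k i.

Let u_bound k i : 0 <= u k i <= 4 * eta.
Proof.
rewrite cross_diff_hat_ge0//=.
by apply: le_trans (ler_norm _) _; exact: cross_diff_hat_le.
Qed.

Let norm_g k i : k != i -> dotp (g k i) (g k i) = 2 - u k i.
Proof. by move=> ki; rewrite dotp_residual_diff// -dotp_true_diff norm_f. Qed.

Let norm_g_gt0 k i : k != i -> 0 < 2 - u k i.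
Proof. move=> ki; have /andP[_ u4] := u_bound k i.
by rewrite subr_gt0 (le_lt_trans u4)//; have := eta_small; lra. Qed.

Let q_g_g k i l j : k != i -> l != j -> q (g k i) (g l j) =
  1 / 2 - acos ((cross_diff 1%:M k i l j - cross_diff H k i l j) /
    (Num.sqrt (2 - u k i) * Num.sqrt (2 - u l j))) / (2 * pi).
Proof.
move=> ki lj; rewrite /q (gaussian_family_orthant s0 n1 gX) !norm_g//;
  by rewrite ?dotp_residual_diff// gt_eqF// norm_g_gt0.
Qed.

Let q_g_f k i l j : k != i -> l != j -> q (g k i) (f l j) =
  1 / 2 - acos ((cross_diff 1%:M k i l j - cross_diff H k i l j) /
    (Num.sqrt (2 - u k i) * Num.sqrt 2)) / (2 * pi).
Proof.
move=> ki lj; rewrite /q (gaussian_family_orthant s0 n1 gX) ?norm_g ?norm_f//.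
  by rewrite dotp_residual_true_diff.
by rewrite gt_eqF// norm_g_gt0.
Qed.

Let q_f_g k i l j : k != i -> l != j -> q (f k i) (g l j) =
  1 / 2 - acos ((cross_diff 1%:M k i l j - cross_diff H k i l j) /
    (Num.sqrt 2 * Num.sqrt (2 - u l j))) / (2 * pi).
Proof.
move=> ki lj; rewrite /q (gaussian_family_orthant s0 n1 gX) ?norm_g ?norm_f//.
  rewrite dotp_sym dotp_residual_true_diff// /cross_diff.
  rewrite [H l k](hat_matrixC) [H l i]hat_matrixC [H j k]hat_matrixC.
  rewrite [H j i]hat_matrixC !mxE.
  rewrite (eq_sym l k) (eq_sym l i) (eq_sym j k) (eq_sym j i).
  congr (_ - acos (_ / _) / _); ring.
by rewrite gt_eqF// norm_g_gt0.
Qed.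

Let q_f_f k i l j : k != i -> l != j -> q (f k i) (f l j) =
  1 / 2 - acos (cross_diff 1%:M k i l j / (Num.sqrt 2 * Num.sqrt 2)) / (2 * pi).
Proof.
move=> ki lj; rewrite /q (gaussian_family_orthant s0 n1 gX) ?norm_f//.
by rewrite dotp_true_diff.
Qed.

Let Y_le1 k i w : `|Y k i w| <= 1.
Proof.
by rewrite /Y; do 2 case: (neg _ _);
  rewrite ?subrr ?subr0 ?sub0r ?normrN ?normr0 ?normr1 ?ler01.
Qed.

Let Y_sqr k i w : Y k i w * Y k i w = `|Y k i w|.
Proof.
by rewrite /Y; do 2 case: (neg _ _);
  rewrite ?subrr ?subr0 ?sub0r ?mulr0 ?mulrNN ?mulr1 ?normrN ?normr0 ?normr1.
Qed.

(** As [Y] takes values in -1, 0, 1, a product of two of them is bounded by the square of the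
    first. *)
Let m_le_sqr k i l j : `|m k i l j| <= m k i k i.
Proof.
have YY w : `|Y k i w * Y l j w| <= Y k i w * Y k i w.
  by rewrite Y_sqr normrM ler_piMr// Y_le1.
rewrite ler_norml; apply/andP; split.
  apply: (has_mean_le (has_meanN (mean_Y k i k i)) (mean_Y k i l j)) => w.
  by have := YY w; rewrite ler_norml => /andP[].
apply: (has_mean_le (mean_Y k i l j) (mean_Y k i k i)) => w.
by have := YY w; rewrite ler_norml => /andP[].
Qed.

(* The mean square of the discrepancy is the angle between the two difference
   vectors, in units of [pi]; it is of order [sqrt eta]. *)
Let m_sqr_le k i : k != i -> m k i k i <= 2 * Num.sqrt eta.
Proof.
move=> ki; have /andP[u0 u4] := u_bound k i.
have v0 := norm_g_gt0 ki; have e48 := eta_small.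
have pi0 := pi_gt0 R; have pi2 := pi_ge2 R.
rewrite /m (q_g_g ki ki) (q_g_f ki ki) (q_f_g ki ki) (q_f_f ki ki).
have c2 : cross_diff 1%:M k i k i = 2 :> R by rewrite -dotp_true_diff norm_f.
rewrite c2 -/(u k i) -!expr2 (sqr_sqrtr (ltW v0)) (sqr_sqrtr (ltW (ltr0Sn R 1))).
rewrite !divff ?gt_eqF// acos1.
rewrite [Num.sqrt 2 * _]mulrC.
have -> : (2 - u k i) / (Num.sqrt (2 - u k i) * Num.sqrt 2) =
    Num.sqrt (1 - u k i / 2).
  rewrite -[X in X / _](sqr_sqrtr (ltW v0)) expr2 invfM mulrACA.
  rewrite divff ?mul1r; last by rewrite gt_eqF// sqrtr_gt0.
  by rewrite -sqrtrV// -sqrtrM ?ltW//; congr Num.sqrt; field.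
have u2 : 0 <= u k i / 2 <= 3 / 4 by apply/andP; split; lra.
have ac := acos_sqrt_le u2.
have sq : Num.sqrt (u k i / 2) <= Num.sqrt (4 * eta) by rewrite ler_wsqrtr//; lra.
have sq4 : Num.sqrt (4 * eta) = 2 * Num.sqrt eta.
  by rewrite sqrtrM// (_ : 4 = 2 ^+ 2 :> R) ?sqrtr_sqr ?ger0_norm//; ring.
have th0 : 0 <= acos (Num.sqrt (1 - u k i / 2)).
  apply: acos_ge0; apply/andP; split.
    by apply: le_trans (sqrtr_ge0 _); rewrite lerN10.
  by rewrite -[leRHS]sqrtr1 ler_wsqrtr//; lra.
move: (acos _) (Num.sqrt (u k i / 2)) (Num.sqrt (4 * eta)) (Num.sqrt eta)
  ac sq sq4 th0 => th r r4 re ac sq sq4 th0.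
have -> : 1 / 2 - 0 / (2 * pi) - (1 / 2 - th / (2 * pi)) -
    (1 / 2 - th / (2 * pi)) + (1 / 2 - 0 / (2 * pi)) = th / pi.
  by move: (@pi R) pi0 => PI PI0; field; rewrite gt_eqF.
(* The angle is at most [2 * sqrt (4 * eta) = 4 * sqrt eta], and [pi >= 2]. *)
rewrite ler_pdivrMr//; apply: (@le_trans _ _ (2 * re * 2)); first by lra.
by rewrite ler_wpM2l//; lra.
Qed.

Let Y_refl i w : Y i i w = 0.
Proof.
have Z a : a = (fun=> 0) -> neg a w = true.
  move=> ->; rewrite /neg /linear_form big1 ?lexx// => j _.
  by rewrite mul0r.
rewrite /Y !Z ?subrr//.
  by apply/funext => j; rewrite /true_diff subrr.
by apply/funext => j; rewrite /residual_diff subrr.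
Qed.

(** Here one of the forms is zero, so the orthant formula does not apply; but an index never
    contributes to its own rank error. *)
Let m_null k i l j : (k == i) || (l == j) -> m k i l j = 0.
Proof.
move=> kilj; apply/eqP; rewrite eq_le.
have Y0 w : Y k i w * Y l j w = 0.
  by case/orP: kilj => /eqP ->; rewrite Y_refl ?mulr0 ?mul0r.
have z : has_mean P (fun=> 0) (0 : R).
  split; first exact: integrable0.
  by rewrite integral0.
by apply/andP; split;
  [apply: (has_mean_le (mean_Y k i l j) z)|apply: (has_mean_le z (mean_Y k i l j))]
  => w; rewrite Y0.
Qed.

Let h_null k i l j : (k == i) || (l == j) -> cross_diff H k i l j = 0.
Proof. by rewrite /cross_diff => /orP[]/eqP ->; ring. Qed.

Let slope i j : R := 2 * Num.sqrt (4 - (i == j :> 'I_n)%:R) * pi.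

Let slope_ge4 i j : 4 <= slope i j.
Proof.
have pi2 := pi_ge2 R.
have : 1 <= Num.sqrt (4 - (i == j)%:R) :> R.
  rewrite -[leLHS]sqrtr1 ler_wsqrtr//.
  by case: (i == j) => /=; lra.
by rewrite /slope; move: (Num.sqrt _) (@pi R) pi2 => x PI PI2 x1; nra.
Qed.

(** Degenerate pairs ([k = i] or [l = j]) contribute nothing on either side. The exceptional pairs
    marked by the indicators are bounded crudely, and all others fall under [acos_four_term]. *)
Let m_bound k i l j :
  `|m k i l j - cross_diff H k i l j / slope i j| <=
  300 * eta ^+ 2 +
  3 * Num.sqrt eta * ((k == l)%:R + (k == j)%:R + (l == i)%:R).
Proof.
have e0 : 0 <= eta := max_leverage_ge0 D.
have e48 := eta_small.
have se0 : 0 <= Num.sqrt eta := sqrtr_ge0 _.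
have b0 : 0 <= 300 * eta ^+ 2 by apply: mulr_ge0; [exact: ler0n|exact: sqr_ge0].
have b1 : 0 <= 3 * Num.sqrt eta by apply: mulr_ge0; first exact: ler0n.
have b2 : 0 <= (k == l)%:R + (k == j)%:R + (l == i)%:R :> R.
  by do 2 (apply: addr_ge0; last exact: ler0n); exact: ler0n.
have [kilj|] := boolP ((k == i) || (l == j)).
  rewrite (m_null kilj) (h_null kilj) mul0r subr0 normr0.
  by apply: addr_ge0; last exact: mulr_ge0.
rewrite negb_or => /andP[ki lj].
have [exc|] := boolP [|| k == l, k == j | l == i].
  have ex1 : 1 <= (k == l)%:R + (k == j)%:R + (l == i)%:R :> R.
    by move: exc; case: (k == l); case: (k == j); case: (l == i) => //= _; lra.
  have se : eta <= Num.sqrt eta.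
    have := sqr_sqrtr e0; move: (Num.sqrt eta) se0 => r r0 rr.
    have [r1|r1] := lerP r 1; last by nra.
    by rewrite -rr expr2 ler_piMl.
  (* Together with [eta <= sqrt eta], this adds one [sqrt eta] to the two coming from [m_sqr_le],
     hence the factor 3. *)
  have hs : `|cross_diff H k i l j / slope i j| <= eta.
    have s4 := slope_ge4 i j.
    rewrite normrM normfV [X in _ / X]gtr0_norm; last by lra.
    rewrite ler_pdivrMr; last by lra.
    apply: le_trans (cross_diff_hat_le rankD k i l j) _.
    by rewrite mulrC ler_wpM2l.
  have mb : `|m k i l j| <= 2 * Num.sqrt eta.
    exact: le_trans (m_le_sqr _ _ _ _) (m_sqr_le ki).
  apply: le_trans (ler_normB _ _) _.
  apply: (@le_trans _ _ (3 * Num.sqrt eta * 1)).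
    by rewrite mulr1; lra.
  rewrite -[leLHS]add0r; apply: lerD; first exact: b0.
  exact: ler_wpM2l.
rewrite !negb_or => /and3P[kl kj li].
(* For a generic pair the unprojected differences share at most the vector with index [i = j]. *)
have cE : cross_diff 1%:M k i l j = (i == j)%:R :> R.
  rewrite /cross_diff !mxE (negbTE kl) (negbTE kj) [i == l]eq_sym (negbTE li).
  by rewrite !subr0 add0r.
rewrite (negbTE kl) (negbTE kj) (negbTE li) !addr0 mulr0 addr0.
rewrite /m (q_g_g ki lj) (q_g_f ki lj) (q_f_g ki lj) (q_f_f ki lj) cE.
apply: acos_four_term; first by rewrite e0.
- exact: cross_diff_hat_le.
- exact: u_bound.
- exact: u_bound.
Qed.

Lemma rank_moment (i j : 'I_n) : H *m (const_mx 1 : 'cV[R]_n) = const_mx 1 ->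
  exists M, has_mean P (fun w => rank_error D (\col_k X k w) i *
                                 rank_error D (\col_k X k w) j) M /\
  `|M - (n%:R ^+ 2 * H i j - n%:R) / (2 * Num.sqrt (4 - (i == j)%:R) * pi)| <=
  300 * (n%:R * Num.sqrt eta + n%:R ^+ 2 * eta ^+ 2).
Proof.
move=> H1; exists (\sum_k \sum_l m k i l j); split.
  have YE i' w : rank_error D (\col_k X k w) i' = \sum_k Y k i' w.
    rewrite /rank_error /rank_of !natr_sum -sumrB; apply: eq_bigr => k _.
    have LE a : \sum_b a b * (\col_k X k w) b ord0 = linear_form a X w.
      by apply: eq_bigr => b _; rewrite mxE.
    by rewrite residual_le true_le !LE.
  rewrite (_ : (fun w => _) = (fun w => \sum_k \sum_l Y k i w * Y l j w)).
    by apply: has_mean_sum => k; apply: has_mean_sum => l; exact: mean_Y.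
  by apply/funext => w; rewrite !YE big_distrlr.
rewrite -(sum_cross_diff_hat i j H1) -/(slope i j) mulr_suml -sumrB.
apply: le_trans (ler_norm_sum _ _ _) _.
apply: (@le_trans _ _ (\sum_(k < n) \sum_(l < n) (300 * eta ^+ 2 +
    3 * Num.sqrt eta * ((k == l)%:R + (k == j)%:R + (l == i)%:R)))).
  apply: ler_sum => k _; rewrite mulr_suml -sumrB.
  apply: le_trans (ler_norm_sum _ _ _) _.
  by apply: ler_sum => l _; exact: m_bound.
have delta (a : 'I_n) : \sum_b (b == a)%:R = 1 :> R.
  by rewrite (bigD1 a)//= eqxx big1 ?addr0// => b /negbTE ->.
(* Over all pairs the three indicators sum to [3 * n], so the exceptional total is
   [9 * n * sqrt eta], well within the constant 300. *)
have inner (k : 'I_n) : \sum_(l < n) (300 * eta ^+ 2 +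
    3 * Num.sqrt eta * ((k == l)%:R + (k == j)%:R + (l == i)%:R)) =
    n%:R * (300 * eta ^+ 2) + 3 * Num.sqrt eta * (2 + n%:R * (k == j)%:R).
  rewrite big_split /= sumr_const card_ord mulr_natl -mulr_sumr !big_split /=.
  rewrite sumr_const card_ord -[(k == j)%:R *+ n]mulr_natl delta.
  rewrite (eq_bigr (fun l => (l == k)%:R)) ?delta; last first.
    by move=> l _; rewrite eq_sym.
  by congr (_ + _ * _); ring.
under eq_bigr do rewrite inner.
rewrite big_split /= sumr_const card_ord -mulr_sumr big_split /= sumr_const.
rewrite card_ord -mulr_sumr delta.
rewrite -[_ *+ n]mulr_natl -[2 *+ n]mulr_natl.
have : 0 <= n%:R * Num.sqrt eta by rewrite mulr_ge0// sqrtr_ge0.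
rewrite !mulrDr !mulrA; lra.
Qed.

End rank_moments.

Local Close Scope classical_set_scope.

Theorem theorem2 (R : realType) :
  exists C eta0 : R, 0 < C /\ 0 < eta0 /\
  forall (n p : nat) (D : 'M[R]_(n, p)) (sigma : R)
    (d : measure_display) (T : measurableType d) (P : probability T R)
    (eps : 'I_n -> {RV P >-> R}),
    (1 <= p)%N -> (p < n)%N ->
    \rank D = p ->
    0 < sigma ->
    independent_RVs eps ->
    (forall i : 'I_n, centered_normal sigma (eps i)) ->
    hat_matrix D *m (const_mx 1 : 'cV[R]_n) = const_mx 1 ->
    max_leverage D <= eta0 ->
    forall i j : 'I_n,
      (`| 'E_P[fun w : T => (rank_error D (random_vector eps w) i
                           * rank_error D (random_vector eps w) j)%R]
          - ((n%:R ^+ 2 * hat_matrix D i j - n%:R)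
             / (2 * Num.sqrt (4 - (i == j)%:R) * pi))%:E |
       <= (C * (n%:R * Num.sqrt (max_leverage D)
                + n%:R ^+ 2 * max_leverage D ^+ 2))%:E)%E.
Proof.
(* Both constants are those of [acos_four_term]. *)
exists 300, (1 / 48); split; first exact: ltr0n.
split; first by rewrite divr_gt0.
move=> n p D sigma d T P eps p1 pn rankD sigma0 ind nor H1 eta_small i j.
have gX := independent_normal_gaussian_family ind nor.
have [M [/has_mean_expectation ME Mbound]] :=
  rank_moment sigma0 (leq_ltn_trans p1 pn) rankD gX eta_small i j H1.
by rewrite ME -EFinB abse_EFin lee_fin.
Qed.
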